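(* Consider a networked system with graph $\mathcal G=(\mathcal V,\mathcal E)$ and matrices $A,B,Q,R$ as in the context. Suppose there are $L>1$, $\alpha\in(0,1)$, $\gamma\in(0,1)$ such that (a) $\|A\|,\|B\|,\|Q\|,\|R\|\le L$; (b) $R\succeq\gamma I$; (c) $(A,B)$ is $(L,\alpha)$-stabilizable; (d) $Q\succeq 0$ and $(A,Q^{1/2})$ is $(L,\alpha)$-detectable. Let $K^\star=\{K^\star_{ij}\}_{i,j\in\mathcal V}$ be the optimal gain of the infinite-horizon linear-quadratic regulator. Then, with the constants $\Upsilon,\rho$ defined from $L,\alpha,\gamma$ in the context, $$\|K^\star_{ij}\|\le \Upsilon\,\rho^{\,d_{\mathcal G}(i,j)}\qquad\text{for all } i,j\in\mathcal V .$$ Furthermore, $\rho\in(0,1)$ and $\Upsilon\ge 1$.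
   Context: Setting. $\mathcal G=(\mathcal V,\mathcal E)$ is a finite undirected graph without self-loops, $\mathcal V=\{1,\dots,N\}$; $d_{\mathcal G}(i,j)$ is the number of edges in a shortest path from $i$ to $j$ (with $d_{\mathcal G}(i,j)=+\infty$ and $\rho^{+\infty}:=0$ if there is no path). Each node $i$ has a state $x_i(t)\in\mathbb R^{n_{x_i}}$ and control $u_i(t)\in\mathbb R^{n_{u_i}}$. Real blocks $A_{ij}\in\mathbb R^{n_{x_i}\times n_{x_j}}$, $B_{ij}\in\mathbb R^{n_{x_i}\times n_{u_j}}$, $Q_{ij}\in\mathbb R^{n_{x_i}\times n_{x_j}}$, $R_{ij}\in\mathbb R^{n_{u_i}\times n_{u_j}}$ are given, with $Q_{ij}=Q_{ji}^\top$, $R_{ij}=R_{ji}^\top$, and all four blocks equal to zero whenever $i\ne j$ and $\{i,j\}\notin\mathcal E$. Set $A=\{A_{ij}\}$, $B=\{B_{ij}\}$, $Q=\{Q_{ij}\}$, $R=\{R_{ij}\}$ (block matrices indexed by $i,j\in\mathcal V$), $x=\{x_i\}_{i\in\mathcal V}$, $u=\{u_i\}_{i\in\mathcal V}$. $\|\cdot\|$ is the Euclidean norm for vectors and the induced 2-norm for matrices; $M\succeq M'$ means $M-M'$ is positive semidefinite. Stability notions, for $L>0$, $\alpha\in[0,1)$: a square matrix $\Phi$ is $(L,\alpha)$-stable if $\|\Phi^t\|\le L\alpha^t$ for all integers $t\ge 0$; $(A,B)$ is $(L,\alpha)$-stabilizable if there is $\overline K$ with $\|\overline K\|\le L$ and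 $A-B\overline K$ $(L,\alpha)$-stable; $(A,C)$ is $(L,\alpha)$-detectable if $(A^\top,C^\top)$ is $(L,\alpha)$-stabilizable. Linear-quadratic regulator (LQR): minimize $\sum_{t=0}^\infty \tfrac12 x(t)^\top Qx(t)+\tfrac12u(t)^\top Ru(t)$ subject to $x(0)=\overline x$, $x(t+1)=Ax(t)+Bu(t)$ for $t\ge0$. The optimal policy is the linear feedback $u=-K^\star x$; explicitly $K^\star=(R+B^\top P^\star B)^{-1}B^\top P^\star A$, where $P^\star$ is the unique positive semidefinite solution of $P=A^\top PA-A^\top PB(R+B^\top PB)^{-1}B^\top PA+Q$. $K^\star$ is partitioned into blocks $K^\star_{ij}\in\mathbb R^{n_{u_i}\times n_{x_j}}$. Constants (in terms of $L,\alpha,\gamma$): $\gamma_F=\frac{(1-\alpha)^2}{L^2(1+L)^2}$, $\gamma_G=\frac{(1-\alpha)^2\gamma}{2L^4(1+L)^2}$, $L_P=\frac{L^3(1+L^2)}{1-\alpha^2}$, $L_H=\max(2L+1,\,L_P+1)$, $\overline\mu=\big(2L_H^2/\gamma_G+\gamma_G+L_H\big)/\gamma_F$, $\gamma_H=\Big(\frac{2}{\gamma_G}+\big(1+\frac{4L_H}{\gamma_G}+\frac{4L_H^2}{\gamma_G^2}\big)\frac{L_H(1+\overline\mu L_H)}{\gamma_F}+\overline\mu\Big)^{-1}$, $\rho=\Big(\frac{L_H^2-\gamma_H^2}{L_H^2+\gamma_H^2}\Big)^{1/2}$, $\Upsilon=\frac{L_H}{\gamma_H^2\,\rho}$. *)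

(* Defs.v *)
From HB Require Import structures.
From mathcomp Require Import all_boot all_order all_algebra.
From mathcomp Require Import all_classical all_reals all_analysis.
Import Order.TTheory GRing.Theory Num.Theory.

Set Implicit Arguments.
Unset Strict Implicit.
Unset Printing Implicit Defensive.

Local Open Scope classical_set_scope.
Local Open Scope ring_scope.

(* [path e i p] only constrains the walk i :: p; [uniq] makes it a path in the
   graph-theoretic sense, with [size p = k] edges. *)
Definition has_path (T : finType) (e : rel T) (i j : T) (k : nat) : bool :=
  [exists p : k.-tuple T, [&& path e i p, last i p == j & uniq (i :: p)]].

(* [None] stands for the distance +oo. *)
Definition gdist (T : finType) (e : rel T) (i j : T) : option nat :=
  if pselect (exists k, has_path e i j k) is left ex_path
  then Some (ex_minn ex_path) else None.

Definition expr_dist (F : realType) (r : F) (d : option nat) : F :=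
  if d is Some k then r ^+ k else 0.

Section LinearAlgebra.
Variable F : realType.

(* The library's norm on matrices is the max norm, so the Euclidean norm and
   the operator norm it induces are defined here. *)
Definition norm2 (n : nat) (x : 'cV[F]_n) : F :=
  Num.sqrt (\sum_(i < n) x i 0 ^+ 2).

Definition mxnorm2 (m n : nat) (M : 'M[F]_(m, n)) : F :=
  sup [set norm2 (M *m x) | x in [set x : 'cV[F]_n | norm2 x <= 1]].

Definition quadf (n : nat) (M : 'M[F]_n) (x : 'cV[F]_n) : F :=
  (x^T *m M *m x) 0 0.

Definition psdmx (n : nat) (M : 'M[F]_n) : Prop :=
  M^T = M /\ forall x : 'cV[F]_n, 0 <= quadf M x.

Definition psdmx_ge (n : nat) (M M' : 'M[F]_n) : Prop := psdmx (M - M').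

(* S = M^{1/2}: a positive semidefinite M has exactly one such S. *)
Definition is_psd_sqrt (n : nat) (M S : 'M[F]_n) : Prop :=
  psdmx S /\ S *m S = M.

Definition stable (L alpha : F) (n : nat) (Phi : 'M[F]_n) : Prop :=
  forall t : nat, mxnorm2 (Phi ^+ t) <= L * alpha ^+ t.

Definition stabilizable (L alpha : F) (n m : nat)
    (A : 'M[F]_n) (B : 'M[F]_(n, m)) : Prop :=
  exists K : 'M[F]_(m, n), mxnorm2 K <= L /\ stable L alpha (A - B *m K).

Definition detectable (L alpha : F) (n m : nat)
    (A : 'M[F]_n) (C : 'M[F]_(m, n)) : Prop :=
  stabilizable L alpha A^T C^T.

End LinearAlgebra.

Section LQR.
Variables (F : realType) (n m : nat).
Variables (A : 'M[F]_n) (B : 'M[F]_(n, m)) (Q : 'M[F]_n) (R : 'M[F]_m).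
Implicit Types (x : nat -> 'cV[F]_n) (u : nat -> 'cV[F]_m).

Definition lqr_feasible (x0 : 'cV[F]_n) x u : Prop :=
  x 0%N = x0 /\ forall t, x t.+1 = A *m x t + B *m u t.

Definition lqr_cost x u : \bar F :=
  (\sum_(0 <= t <oo) (2^-1 * quadf Q (x t) + 2^-1 * quadf R (u t))%:E)%E.

Definition lqr_optimal (x0 : 'cV[F]_n) x u : Prop :=
  lqr_feasible x0 x u /\
  forall x' u', lqr_feasible x0 x' u' -> (lqr_cost x u <= lqr_cost x' u')%E.

Definition lqr_optimal_gain (K : 'M[F]_(m, n)) : Prop :=
  forall (x0 : 'cV[F]_n) x u, lqr_feasible x0 x u -> (forall t, u t = - (K *m x t)) ->
    lqr_optimal x0 x u.

End LQR.

Section Constants.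
Variables (F : realType) (L alpha gamma : F).

Definition gammaF : F := (1 - alpha) ^+ 2 / (L ^+ 2 * (1 + L) ^+ 2).

Definition gammaG : F :=
  (1 - alpha) ^+ 2 * gamma / (2 * L ^+ 4 * (1 + L) ^+ 2).

Definition constLP : F := L ^+ 3 * (1 + L ^+ 2) / (1 - alpha ^+ 2).

Definition constLH : F := Num.max (2 * L + 1) (constLP + 1).

Definition mubar : F :=
  (2 * constLH ^+ 2 / gammaG + gammaG + constLH) / gammaF.

Definition gammaH : F :=
  (2 / gammaG
   + (1 + 4 * constLH / gammaG + 4 * constLH ^+ 2 / gammaG ^+ 2)
     * (constLH * (1 + mubar * constLH) / gammaF)
   + mubar)^-1.

Definition rho : F :=
  Num.sqrt ((constLH ^+ 2 - gammaH ^+ 2) / (constLH ^+ 2 + gammaH ^+ 2)).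

Definition Upsilon : F := constLH / (gammaH ^+ 2 * rho).

End Constants.

(* Main.v *)
Require Import Defs.
From mathcomp Require Import all_boot all_order all_algebra.
From mathcomp Require Import all_classical all_reals all_analysis.
From mathcomp Require Import ring lra.
Import Order.TTheory GRing.Theory Num.Theory.
Import numFieldNormedType.Exports.

(** The optimal trajectory, together with the costate [P x(t)], satisfies the
    first-order (KKT) system of the finite-horizon problem with horizon [T], up
    to a residual at the last time step that is small when [x(T)] is. The KKT
    operator [H] is symmetric and couples only neighbouring nodes; stabilizability
    and detectability give [gammaH |z| <= |H z| <= constLH |z|] uniformly in [T].
    Richardson's iteration for [H^2 z = H b], started at 0, contracts the error by
    [rho^2] per step, while its k-th iterate, for an initial state carried by node
    [j], vanishes at the nodes at distance at least [2k] from [j]. Hence the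
    control of node [i] is at most [rho^(2k) / gammaH] whenever
    [2k <= d(i, j)]. *)

Set Implicit Arguments.
Unset Strict Implicit.
Unset Printing Implicit Defensive.

Local Open Scope ring_scope.

(** * Frobenius and operator norms *)

(** A finite horizon keeps [H] a linear map between matrices: spectral facts become norm
    inequalities, and Neumann series in the delay are finite sums, the delay being nilpotent. The
    price is the residual at the end of the horizon. For fixed k its effect is at most a constant
    times |x(T)|, and T is chosen only after k: finite optimal cost and detectability make the
    states square summable, hence small at arbitrarily late times. The gain is given by optimality
    alone, not by a Riccati formula. So P is obtained from the Lyapunov equation of the closed loop,
    and the costate equations come from comparison with a control altered at time 0 only. When d(i,
    j) is odd, the choice of k as half of it loses one factor [rho], which the 1 / [rho] in
    [Upsilon] restores; the rest of [Upsilon] dominates 1 / [gammaH] because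
    [gammaH <= 1 < constLH]. *)

(** The minimiser t = -b/c gives the claim when c > 0. No definiteness is assumed, so this yields
    Cauchy-Schwarz for semidefinite forms and, with a = 0, forces a first-order term to vanish. *)
Lemma quad_discr (F : realFieldType) (a b c : F) :
  (forall t, 0 <= a + 2 * t * b + t ^+ 2 * c) -> b ^+ 2 <= a * c.
Proof.
move=> h.
have a0 : 0 <= a by have := h 0; rewrite mulr0 mul0r expr0n mul0r !addr0.
have [c0|c0] := eqVneq c 0.
  have [->|b0] := eqVneq b 0; first by rewrite c0 mulr0 expr0n.
  have := h (- (a + 1) / (2 * b)).
  suff -> : a + 2 * (- (a + 1) / (2 * b)) * b + (- (a + 1) / (2 * b)) ^+ 2 * c = -1.
    by rewrite ler0N1.
  by rewrite c0; field.
have cp : 0 < c.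
  rewrite lt_neqAle eq_sym c0 /= leNgt; apply/negP => cn.
  have h1 := h 1; have hm := h (-1).
  (* For c < 0 the values at t and -t average to a + t^2 c. This t satisfies t <= -(a + 1) and t c =
     (a + 1)(1 - c) > 1, which makes the average negative. *)
  have := h ((a + 1) / c - (a + 1) ); have := h (- ((a + 1) / c - (a + 1))).
  set t := _ - _ => h2 h3.
  have : 0 <= a + t ^+ 2 * c by nra.
  have ct : t * c = (a + 1) * (1 - c) by rewrite /t; field.
  have -> : t ^+ 2 * c = t * (t * c) by ring.
  rewrite ct; have : t <= - (a + 1).
    rewrite /t lerBlDr addNr pmulr_rle0 ?invr_le0 ?ltW //; lra.
  nra.
have := h (- b / c).
have -> : a + 2 * (- b / c) * b + (- b / c) ^+ 2 * c = (a * c - b ^+ 2) / c by field.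
by rewrite pmulr_lge0 ?invr_gt0 // subr_ge0.
Qed.

Section Frobenius.
Variable F : realType.

(** The Frobenius product, since trajectories are matrices; on a single column it is the Euclidean
    product. *)
Definition fip (a b : nat) (X Y : 'M[F]_(a, b)) : F := \tr (X^T *m Y).
Definition fnorm (a b : nat) (X : 'M[F]_(a, b)) : F := Num.sqrt (fip X X).

Lemma fipE a b (X Y : 'M[F]_(a, b)) : fip X Y = \sum_j \sum_i X i j * Y i j.
Proof.
by rewrite /fip /mxtrace; apply: eq_bigr => j _; rewrite mxE; apply: eq_bigr => i _; rewrite mxE.
Qed.

Lemma fipC a b (X Y : 'M[F]_(a, b)) : fip X Y = fip Y X.
Proof. by rewrite /fip -mxtrace_tr trmx_mul trmxK. Qed.

Lemma fipDl a b (X Y Z : 'M[F]_(a, b)) : fip (X + Y) Z = fip X Z + fip Y Z.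
Proof. by rewrite /fip raddfD /= mulmxDl mxtraceD. Qed.

Lemma fipDr a b (X Y Z : 'M[F]_(a, b)) : fip Z (X + Y) = fip Z X + fip Z Y.
Proof. by rewrite fipC fipDl !(fipC Z). Qed.

Lemma fipZl a b c (X Y : 'M[F]_(a, b)) : fip (c *: X) Y = c * fip X Y.
Proof. by rewrite /fip linearZ /= -scalemxAl mxtraceZ. Qed.

Lemma fipZr a b c (X Y : 'M[F]_(a, b)) : fip X (c *: Y) = c * fip X Y.
Proof. by rewrite fipC fipZl fipC. Qed.

Lemma fipNl a b (X Y : 'M[F]_(a, b)) : fip (- X) Y = - fip X Y.
Proof. by rewrite -scaleN1r fipZl mulN1r. Qed.

Lemma fipNr a b (X Y : 'M[F]_(a, b)) : fip X (- Y) = - fip X Y.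
Proof. by rewrite fipC fipNl fipC. Qed.

Lemma fip0r a b (X : 'M[F]_(a, b)) : fip X 0 = 0.
Proof. by rewrite -(scale0r 0) fipZr mul0r. Qed.

Lemma fip_mull a b c (M : 'M[F]_(c, a)) (X : 'M[F]_(a, b)) Y :
  fip (M *m X) Y = fip X (M^T *m Y).
Proof. by rewrite /fip trmx_mul mulmxA. Qed.

Lemma fip_mulr a b c (M : 'M[F]_(b, c)) (X : 'M[F]_(a, b)) Y :
  fip (X *m M) Y = fip X (Y *m M^T).
Proof. by rewrite /fip trmx_mul -mulmxA mxtrace_mulC mulmxA. Qed.

Lemma fip_tr a b (X Y : 'M[F]_(a, b)) : fip X^T Y^T = fip X Y.
Proof. by rewrite fipC /fip trmxK mxtrace_mulC. Qed.

Lemma fip_ge0 a b (X : 'M[F]_(a, b)) : 0 <= fip X X.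
Proof. by rewrite fipE; do 2!(apply: sumr_ge0 => ? _); rewrite -expr2 sqr_ge0. Qed.

Lemma fnorm_sqr a b (X : 'M[F]_(a, b)) : fnorm X ^+ 2 = fip X X.
Proof. by rewrite sqr_sqrtr ?fip_ge0. Qed.

Lemma fnorm_ge0 a b (X : 'M[F]_(a, b)) : 0 <= fnorm X.
Proof. exact: sqrtr_ge0. Qed.
Hint Resolve fnorm_ge0 : core.

Lemma fip_le a b (X Y : 'M[F]_(a, b)) : fip X Y <= fnorm X * fnorm Y.
Proof.
apply: (le_trans (ler_norm _)).
rewrite -(ler_pXn2r (ltn0Sn 1)) ?nnegrE ?mulr_ge0 // exprMn !fnorm_sqr.
rewrite real_normK ?num_real //.
apply: quad_discr => t; have := fip_ge0 (X + t *: Y).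
rewrite fipDl !fipDr !fipZl !fipZr (fipC Y X); congr (_ <= _); ring.
Qed.

Lemma fnormD a b (X Y : 'M[F]_(a, b)) : fnorm (X + Y) <= fnorm X + fnorm Y.
Proof.
rewrite -(ler_pXn2r (ltn0Sn 1)) ?nnegrE ?addr_ge0 // fnorm_sqr.
rewrite fipDl !fipDr (fipC Y X) sqrrD !fnorm_sqr.
have := fip_le X Y; lra.
Qed.

Lemma fnormZ a b c (X : 'M[F]_(a, b)) : fnorm (c *: X) = `|c| * fnorm X.
Proof. by rewrite /fnorm fipZl fipZr mulrA -expr2 sqrtrM ?sqr_ge0 // sqrtr_sqr. Qed.

Lemma fnormN a b (X : 'M[F]_(a, b)) : fnorm (- X) = fnorm X.
Proof. by rewrite -scaleN1r fnormZ normrN1 mul1r. Qed.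

Lemma fnormB a b (X Y : 'M[F]_(a, b)) : fnorm (X - Y) <= fnorm X + fnorm Y.
Proof. by rewrite -(fnormN Y); apply: fnormD. Qed.

Lemma fnorm0 a b : fnorm (0 : 'M[F]_(a, b)) = 0.
Proof. by rewrite /fnorm fip0r sqrtr0. Qed.

Lemma fnorm_sum a b (I : Type) (r : seq I) (G : I -> 'M[F]_(a, b)) :
  fnorm (\sum_(i <- r) G i) <= \sum_(i <- r) fnorm (G i).
Proof.
elim/big_ind2: _ => [|x1 x2 y1 y2 h1 h2|//]; first by rewrite fnorm0.
by apply: (le_trans (fnormD _ _)); apply: lerD.
Qed.

Lemma fnorm_eq0 a b (X : 'M[F]_(a, b)) : fnorm X = 0 -> X = 0.
Proof.
move=> h; have : fip X X = 0 by rewrite -fnorm_sqr h expr0n.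
rewrite fipE => /eqP; rewrite psumr_eq0; last first.
  by move=> j _; apply: sumr_ge0 => i _; rewrite -expr2 sqr_ge0.
move=> /allP /= h2; apply/matrixP => i j; rewrite mxE.
have := h2 j (mem_index_enum _); rewrite psumr_eq0; last first.
  by move=> k _; rewrite -expr2 sqr_ge0.
by move=> /allP /(_ i (mem_index_enum _)) /=; rewrite mulf_eq0 orbb => /eqP.
Qed.

Lemma fnorm_tr a b (X : 'M[F]_(a, b)) : fnorm X^T = fnorm X.
Proof. by rewrite /fnorm fip_tr. Qed.

Lemma fip_col_mx a1 a2 b (X1 Y1 : 'M[F]_(a1, b)) (X2 Y2 : 'M[F]_(a2, b)) :
  fip (col_mx X1 X2) (col_mx Y1 Y2) = fip X1 Y1 + fip X2 Y2.
Proof. by rewrite /fip tr_col_mx mul_row_col mxtraceD. Qed.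

Lemma fnorm_col_mx a1 a2 b (X1 : 'M[F]_(a1, b)) (X2 : 'M[F]_(a2, b)) :
  fnorm (col_mx X1 X2) ^+ 2 = fnorm X1 ^+ 2 + fnorm X2 ^+ 2.
Proof. by rewrite !fnorm_sqr fip_col_mx. Qed.

Lemma fnorm_col_mx_le a1 a2 b (X1 : 'M[F]_(a1, b)) (X2 : 'M[F]_(a2, b)) :
  fnorm (col_mx X1 X2) <= fnorm X1 + fnorm X2.
Proof.
rewrite -(ler_pXn2r (ltn0Sn 1)) ?nnegrE ?addr_ge0 // fnorm_col_mx sqrrD.
have : 0 <= fnorm X1 * fnorm X2 by rewrite mulr_ge0.
lra.
Qed.

Lemma fnorm_col_mx_u a1 a2 b (X1 : 'M[F]_(a1, b)) (X2 : 'M[F]_(a2, b)) :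
  fnorm X1 <= fnorm (col_mx X1 X2).
Proof.
rewrite -(ler_pXn2r (ltn0Sn 1)) ?nnegrE // fnorm_col_mx.
by rewrite lerDl sqr_ge0.
Qed.

Lemma fnorm_col_mx_d a1 a2 b (X1 : 'M[F]_(a1, b)) (X2 : 'M[F]_(a2, b)) :
  fnorm X2 <= fnorm (col_mx X1 X2).
Proof.
rewrite -(ler_pXn2r (ltn0Sn 1)) ?nnegrE // fnorm_col_mx.
by rewrite lerDr sqr_ge0.
Qed.

Lemma fip_sum_col a b (X Y : 'M[F]_(a, b)) :
  fip X Y = \sum_t fip (col t X) (col t Y).
Proof.
rewrite fipE; apply: eq_bigr => t _; rewrite fipE big_ord1.
by apply: eq_bigr => i _; rewrite !mxE.
Qed.

Lemma norm2E n (x : 'cV[F]_n) : norm2 x = fnorm x.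
Proof.
by rewrite /norm2 /fnorm fipE big_ord1; congr Num.sqrt; apply: eq_bigr => i _; rewrite expr2.
Qed.

Lemma quadfE n (M : 'M[F]_n) (x : 'cV[F]_n) : quadf M x = fip x (M *m x).
Proof. by rewrite /quadf /fip mulmxA /mxtrace big_ord1. Qed.

Definition opbound m n (M : 'M[F]_(m, n)) (c : F) :=
  forall x : 'cV[F]_n, fnorm (M *m x) <= c * fnorm x.

(** The squared Frobenius norm is the sum of the squared norms of the columns, and [M] acts on each
    column. *)
Lemma fnorm_mull m n p (M : 'M[F]_(m, n)) c (X : 'M[F]_(n, p)) :
  0 <= c -> opbound M c -> fnorm (M *m X) <= c * fnorm X.
Proof.
move=> c0 h; rewrite -(ler_pXn2r (ltn0Sn 1)) ?nnegrE ?mulr_ge0 // exprMn !fnorm_sqr.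
rewrite !(fip_sum_col (_ *m _)) (fip_sum_col X) mulr_sumr; apply: ler_sum => t _.
by rewrite -!fnorm_sqr -exprMn colE -mulmxA -colE ler_pXn2r ?nnegrE ?mulr_ge0.
Qed.

(** |M^T x|^2 = <x, M M^T x> <= |x| c |M^T x|; divide by |M^T x|. *)
Lemma opbound_tr m n (M : 'M[F]_(m, n)) c : 0 <= c -> opbound M c -> opbound M^T c.
Proof.
move=> c0 h x; have [->|x0] := eqVneq (fnorm (M^T *m x)) 0; first by rewrite mulr_ge0.
have xp : 0 < fnorm (M^T *m x) by rewrite lt_neqAle eq_sym x0 fnorm_ge0.
rewrite -(ler_pM2r xp) -expr2 fnorm_sqr fip_mull trmxK.
apply: (le_trans (fip_le _ _)); rewrite mulrAC mulrC.
by rewrite ler_wpM2r.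
Qed.

(** Cauchy-Schwarz in each row. It serves where some finite bound is enough, in particular for the
    boundedness of the set under [sup] in [mxnorm2]. *)
Lemma opbound_fnorm m n (M : 'M[F]_(m, n)) : opbound M (fnorm M).
Proof.
move=> x; rewrite -(ler_pXn2r (ltn0Sn 1)) ?nnegrE ?mulr_ge0 // exprMn !fnorm_sqr.
rewrite -fip_tr trmx_mul fip_sum_col -(fip_tr M) (fip_sum_col M^T) mulr_suml.
apply: ler_sum => t _; rewrite -!fnorm_sqr -exprMn.
have -> : col t (x^T *m M^T) = (fip (col t M^T) x)%:M.
  apply/matrixP => i j; rewrite !ord1 mxE [RHS]mxE eqxx mulr1n fipE big_ord1 mxE.
  by apply: eq_bigr => k _; rewrite !mxE mulrC.
rewrite /fnorm fipE !big_ord1 mxE eqxx mulr1n -expr2 sqr_sqrtr ?sqr_ge0 // -real_normK ?num_real //.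
rewrite ler_pXn2r ?nnegrE ?mulr_ge0 //.
rewrite ler_norml; apply/andP; split; last exact: fip_le.
by have := fip_le (- col t M^T) x; rewrite fipNl fnormN lerNl.
Qed.

Lemma opbound_mxnorm2 m n (M : 'M[F]_(m, n)) c : mxnorm2 M <= c -> opbound M c.
Proof.
move=> h x; have [x0|x0] := eqVneq (fnorm x) 0.
  by rewrite (fnorm_eq0 x0) mulmx0 !fnorm0 mulr0.
have xp : 0 < fnorm x by rewrite lt_neqAle eq_sym x0 fnorm_ge0.
rewrite -ler_pdivrMr //; apply: le_trans h.
apply: sup_upper_bound.
  split.
    by exists (norm2 (M *m 0)); exists 0 => //=; rewrite norm2E fnorm0 ler01.
  exists (fnorm M) => _ [y /= hy <-]; rewrite !norm2E in hy *.
  apply: (le_trans (opbound_fnorm _ _)).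
  by rewrite -[leRHS]mulr1 ler_wpM2l.
exists ((fnorm x)^-1 *: x); rewrite /= norm2E.
  by rewrite fnormZ ger0_norm ?invr_ge0 // mulVf.
by rewrite -scalemxAr fnormZ ger0_norm ?invr_ge0 // mulrC.
Qed.

Lemma mxnorm2_le m n (M : 'M[F]_(m, n)) c :
  (forall x : 'cV[F]_n, fnorm x <= 1 -> fnorm (M *m x) <= c) -> mxnorm2 M <= c.
Proof.
move=> h; apply: ge_sup.
  by exists (norm2 (M *m 0)); exists 0 => //=; rewrite norm2E fnorm0 ler01.
by move=> _ [y /= hy <-]; rewrite norm2E; apply: h; rewrite -norm2E.
Qed.

End Frobenius.

#[export] Hint Extern 0 (is_true (0 <= fnorm _)) => solve [apply: fnorm_ge0] : core.

(** * Finite-horizon trajectories *)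

Section Trajectories.
Variable F : realType.

(* A trajectory over the horizon [T] is a matrix whose columns are indexed by
   time; right multiplication by [shiftmx] delays it by one step. *)
Definition traj (n T : nat) (x : nat -> 'cV[F]_n) : 'M[F]_(n, T) :=
  \matrix_(i, t) x t i 0.

Definition untraj (n T : nat) (X : 'M[F]_(n, T)) (t : nat) : 'cV[F]_n :=
  if insub t is Some s then col s X else 0.

Definition delay (n : nat) (x : nat -> 'cV[F]_n) (t : nat) : 'cV[F]_n :=
  if t is t'.+1 then x t' else 0.

Definition shiftmx (T : nat) : 'M[F]_T := \matrix_(s, t) (s.+1 == t)%:R.

Lemma untrajK n T (X : 'M[F]_(n, T)) : traj T (untraj X) = X.
Proof. by apply/matrixP => i t; rewrite mxE /untraj valK mxE. Qed.

Lemma eq_traj n T (x y : nat -> 'cV[F]_n) :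
  (forall t, (t < T)%N -> x t = y t) -> traj T x = traj T y.
Proof. by move=> h; apply/matrixP => i t; rewrite !mxE h. Qed.

Lemma col_traj n T (x : nat -> 'cV[F]_n) (t : 'I_T) : col t (traj T x) = x t.
Proof. by apply/matrixP => i j; rewrite !mxE ord1. Qed.

Lemma mul_traj m n T (M : 'M[F]_(m, n)) (x : nat -> 'cV[F]_n) :
  M *m traj T x = traj T (fun t => M *m x t).
Proof.
by apply/matrixP => i t; rewrite !mxE; apply: eq_bigr => k _; rewrite mxE.
Qed.

Lemma trajD n T (x y : nat -> 'cV[F]_n) :
  traj T x + traj T y = traj T (fun t => x t + y t).
Proof. by apply/matrixP => i t; rewrite !mxE. Qed.

Lemma trajN n T (x : nat -> 'cV[F]_n) : - traj T x = traj T (fun t => - x t).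
Proof. by apply/matrixP => i t; rewrite !mxE. Qed.

Lemma fip_traj n T (x y : nat -> 'cV[F]_n) :
  fip (traj T x) (traj T y) = \sum_(t < T) fip (x t) (y t).
Proof. by rewrite fip_sum_col; apply: eq_bigr => t _; rewrite !col_traj. Qed.

Lemma fnorm_traj1 n T (x : nat -> 'cV[F]_n) (t0 : nat) :
  (t0 < T)%N -> (forall t, t != t0 -> x t = 0) -> fnorm (traj T x) = fnorm (x t0).
Proof.
move=> lt h; rewrite /fnorm fip_traj (bigD1 (Ordinal lt)) //= big1 ?addr0 // => t ht.
by rewrite h ?fip0r.
Qed.

Lemma traj_shift n T (x : nat -> 'cV[F]_n) :
  traj T x *m shiftmx T = traj T (delay x).
Proof.
apply/matrixP => i [[|t] lt]; rewrite !mxE.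
  by rewrite big1 ?mxE // => s _; rewrite !mxE mulr0.
rewrite (bigD1 (Ordinal (ltnW lt))) //= !mxE /= eqxx mulr1 big1 ?addr0 // => s ns.
rewrite !mxE eqSS; case: eqP => [es|]; last by rewrite mulr0.
by case/eqP: ns; apply: val_inj.
Qed.

Lemma traj_shiftT n T (x : nat -> 'cV[F]_n) :
  traj T x *m (shiftmx T)^T = traj T (fun t => if (t.+1 < T)%N then x t.+1 else 0).
Proof.
apply/matrixP => i t; rewrite !mxE; case: ltnP => ht.
  rewrite (bigD1 (Ordinal ht)) //= !mxE /= eqxx mulr1 big1 ?addr0 // => s ns.
  rewrite !mxE; case: eqP => [es|]; last by rewrite mulr0.
  by case/eqP: ns; apply: val_inj.
rewrite big1 ?mxE // => s _; rewrite !mxE.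
by case: eqP => [es|]; rewrite ?mulr0 //; move: (ltn_ord s); rewrite -es ltnNge ht.
Qed.

Lemma fnorm_shift n T (X : 'M[F]_(n, T)) : fnorm (X *m shiftmx T) <= fnorm X.
Proof.
rewrite -(untrajK X); move: (untraj X) => x {X}.
rewrite -(ler_pXn2r (ltn0Sn 1)) ?nnegrE // !fnorm_sqr traj_shift !fip_traj.
case: T => [|T]; first by rewrite !big_ord0.
rewrite big_ord_recl /= fip0r add0r big_ord_recr /=.
by rewrite lerDl fip_ge0.
Qed.

(** Multiplication by the transposed shift is the adjoint of the delay, so the bound passes through
    [opbound_tr]. *)
Lemma fnorm_shiftT n T (X : 'M[F]_(n, T)) : fnorm (X *m (shiftmx T)^T) <= fnorm X.
Proof.
rewrite -fnorm_tr trmx_mul trmxK -(fnorm_tr X) -[leRHS]mul1r; apply: fnorm_mull => // x.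
rewrite -[shiftmx T]trmxK; move: x; apply: opbound_tr => // x.
by rewrite mul1r -fnorm_tr trmx_mul trmxK -(fnorm_tr x); apply: fnorm_shift.
Qed.

Lemma fnorm_shiftX n T (X : 'M[F]_(n, T)) k : fnorm (X *m shiftmx T ^+ k) <= fnorm X.
Proof.
elim: k => [|k ih]; first by rewrite expr0 mulmx1.
by rewrite exprSr mulmxA; apply: le_trans ih; apply: fnorm_shift.
Qed.

(** A delay by the whole horizon pushes every entry out of it. This is what ends the Neumann series
    below without any limit. *)
Lemma shift_nilpotent n T (X : 'M[F]_(n, T)) : X *m shiftmx T ^+ T = 0.
Proof.
rewrite -(untrajK X); move: (untraj X) => x {X}.
have -> k : traj T x *m shiftmx T ^+ k = traj T (fun t => if (t < k)%N then 0 else x (t - k)%N).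
  elim: k => [|k ih].
    by rewrite expr0 mulmx1; apply: eq_traj => t _; rewrite subn0.
  rewrite exprSr mulmxA ih traj_shift; apply: eq_traj => -[|t] _ //=.
by apply/matrixP => i t; rewrite !mxE ltn_ord mxE.
Qed.

(** * Stable and detectable dynamics: bounds uniform in the horizon *)

Section Stable.
Variables (n T : nat) (L a : F) (Psi : 'M[F]_n).
Hypotheses (L0 : 0 <= L) (a0 : 0 <= a) (a1 : a < 1) (st : stable L a Psi).

Lemma fnorm_stable_sum (H : 'M[F]_(n, T)) m :
  fnorm (\sum_(k < m) Psi ^+ k *m H *m shiftmx T ^+ k) <= L / (1 - a) * fnorm H.
Proof.
have p : 0 < 1 - a by rewrite subr_gt0.
apply: (le_trans (fnorm_sum _ _)).
apply: (@le_trans _ _ (\sum_(k < m) L * a ^+ k * fnorm H)).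
  apply: ler_sum => k _; rewrite -mulmxA.
  apply: (le_trans (@fnorm_mull _ _ _ _ _ (L * a ^+ k) _ _ (opbound_mxnorm2 (st k)))).
    by rewrite mulr_ge0 ?exprn_ge0.
  by rewrite ler_wpM2l ?fnorm_shiftX ?mulr_ge0 ?exprn_ge0.
rewrite -mulr_suml -mulr_sumr ler_wpM2r // ler_wpM2l //.
have e : (1 - a) * (\sum_(k < m) a ^+ k) = 1 - a ^+ m.
  by rewrite -[in RHS]opprB subrX1 -mulNr opprB.
rewrite -(ler_pM2l p) e mulfV ?gt_eqF // gerBl exprn_ge0 //.
Qed.

(** Telescoping writes X as minus the Neumann sum of its residual; the geometric series bounds that
    sum independently of [T]. *)
Lemma stable_bound (X : 'M[F]_(n, T)) :
  fnorm X <= L / (1 - a) * fnorm (Psi *m X *m shiftmx T - X).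
Proof.
have {1}-> : X = - \sum_(k < T) Psi ^+ k *m (Psi *m X *m shiftmx T - X) *m shiftmx T ^+ k.
  have e m : \sum_(k < m) Psi ^+ k *m (Psi *m X *m shiftmx T - X) *m shiftmx T ^+ k
    = Psi ^+ m *m X *m shiftmx T ^+ m - X.
    elim: m => [|m ih]; first by rewrite big_ord0 !expr0 mul1mx mulmx1 subrr.
    rewrite big_ord_recr ih /= mulmxBr mulmxBl !mulmxA addrC subrKA.
    by congr (_ - _); rewrite exprSr exprS !mulmxA.
  by rewrite e shift_nilpotent sub0r opprK.
by rewrite fnormN; apply: fnorm_stable_sum.
Qed.

Lemma stable_solve (H : 'M[F]_(n, T)) :
  exists2 X, Psi *m X *m shiftmx T - X = H & fnorm X <= L / (1 - a) * fnorm H.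
Proof.
exists (- \sum_(k < T) Psi ^+ k *m H *m shiftmx T ^+ k); last first.
  by rewrite fnormN; apply: fnorm_stable_sum.
have e m : \sum_(k < m) Psi ^+ k *m H *m shiftmx T ^+ k -
    Psi *m (\sum_(k < m) Psi ^+ k *m H *m shiftmx T ^+ k) *m shiftmx T
    = H - Psi ^+ m *m H *m shiftmx T ^+ m.
  elim: m => [|m ih].
    by rewrite big_ord0 !expr0 mul1mx mulmx1 mulmx0 mul0mx !subrr.
  rewrite big_ord_recr /= mulmxDr mulmxDl opprD addrACA ih subrKA.
  by congr (_ - _); rewrite exprS exprSr !mulmxA.
by rewrite mulmxN mulNmx opprK addrC e shift_nilpotent subr0.
Qed.

End Stable.

(** Output injection: X is a trajectory of the stable matrix A - K^T C, driven by its own dynamics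
    residual, the injected output K^T C X and the input B U. *)
Lemma detectable_bound n m p T (L a : F) (A : 'M[F]_n) (B : 'M[F]_(n, m))
    (C : 'M[F]_(p, n)) (X : 'M[F]_(n, T)) (U : 'M[F]_(m, T)) :
  0 <= L -> 0 <= a -> a < 1 -> opbound B L -> detectable L a A C ->
  fnorm X <= L / (1 - a) * (fnorm ((A *m X + B *m U) *m shiftmx T - X)
                            + L * fnorm (C *m X) + L * fnorm U).
Proof.
move=> L0 a0 a1 hB [K [hK st]].
have st' : stable L a (A - K^T *m C)^T.
  by rewrite linearB /= trmx_mul trmxK.
(* Detectability is stability of the transpose; powers commute with transposition and [opbound_tr]
   keeps the bound. *)
have {}st' : stable L a (A - K^T *m C).
  move=> t; apply: mxnorm2_le => x x1.
  have := opbound_tr _ (opbound_mxnorm2 (st' t)) x.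
  have -> : ((A - K^T *m C)^T ^+ t)^T = (A - K^T *m C) ^+ t.
    elim: t => [|t ih]; first by rewrite !expr0 trmx1.
    by rewrite exprS trmx_mul ih trmxK exprSr.
  have c0 : 0 <= L * a ^+ t by rewrite mulr_ge0 ?exprn_ge0.
  by move=> /(_ c0) h; apply: (le_trans h); rewrite -[leRHS]mulr1 ler_wpM2l.
apply: (le_trans (stable_bound L0 a0 a1 st' X)).
apply: ler_wpM2l; first by rewrite divr_ge0 // subr_ge0 ltW.
have -> : (A - K^T *m C) *m X *m shiftmx T - X =
   ((A *m X + B *m U) *m shiftmx T - X) - (K^T *m (C *m X) *m shiftmx T)
   - B *m U *m shiftmx T.
  rewrite mulmxBl mulmxBl mulmxDl !mulmxA.
  set a1' := A *m X *m _; set b := B *m _ *m _; set c := K^T *m _ *m _ *m _.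
  by rewrite [RHS]addrAC (addrAC (a1' + b)) addrK addrAC.
apply: (le_trans (fnormB _ _)); apply: lerD.
  apply: (le_trans (fnormB _ _)); apply: lerD => //.
  apply: (le_trans (fnorm_shift _)); apply: fnorm_mull => //.
  by apply: opbound_tr => //; apply: opbound_mxnorm2.
by apply: (le_trans (fnorm_shift _)); apply: fnorm_mull.
Qed.

End Trajectories.

(** * The KKT operator *)

(* [gammaF = steering_gain ^- 2] *)
Definition steering_gain (F : realType) (L a : F) : F := L * (1 + L) / (1 - a).

(** Squaring the hypothesis and adding the trivial bound on u gives (1 - a)^2 (x^2 + u^2) <= 3 L^4
    (c^2 + u^2). The factor 2 (1 + L)^2 >= 8 in the denominator of [gammaG] absorbs the 3. *)
Lemma gammaG_arith (F : realType) (L a gam x u c : F) :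
  1 < L -> 0 < a -> a < 1 -> 0 < gam -> gam < 1 -> 0 <= x -> 0 <= u -> 0 <= c ->
  x <= L / (1 - a) * (L * c + L * u) ->
  gammaG L a gam * (x ^+ 2 + u ^+ 2) <= c ^+ 2 + gam * u ^+ 2.
Proof.
move=> L1 a0 a1 g0 g1 x0 u0 c0 hx.
have d0 : 0 < 1 - a by rewrite subr_gt0.
have Lp : 0 < L := lt_trans ltr01 L1.
have L0 := ltW Lp.
rewrite /gammaG mulrAC ler_pdivrMr; last by rewrite !(mulr_gt0, exprn_gt0) ?addr_gt0.
have hx2 : (1 - a) * x <= L ^+ 2 * (c + u).
  apply: (le_trans (ler_wpM2l (ltW d0) hx)).
  rewrite (_ : (1 - a) * (L / _ * _) = L ^+ 2 * (c + u)) //; field.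
  by rewrite gt_eqF.
have hx3 : (1 - a) ^+ 2 * x ^+ 2 <= L ^+ 4 * (2 * (c ^+ 2 + u ^+ 2)).
  have : ((1 - a) * x) ^+ 2 <= (L ^+ 2 * (c + u)) ^+ 2.
    by rewrite ler_pXn2r ?nnegrE ?mulr_ge0 ?exprn_ge0 ?(ltW d0) ?addr_ge0.
  have -> : (L ^+ 2 * (c + u)) ^+ 2 = L ^+ 4 * (c + u) ^+ 2 by ring.
  rewrite exprMn => h; apply: (le_trans h).
  by rewrite ler_wpM2l ?exprn_ge0 //; have := sqr_ge0 (c - u); nra.
have L4 : 1 <= L ^+ 4 by rewrite exprn_ege1 // ltW.
have hu : (1 - a) ^+ 2 * u ^+ 2 <= L ^+ 4 * u ^+ 2.
  rewrite ler_wpM2r ?sqr_ge0 //; apply: le_trans L4; by rewrite exprn_ile1 ?(ltW d0) // gerBl (ltW a0).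
have c2 := sqr_ge0 c; have u2 := sqr_ge0 u.
have k : (1 - a) ^+ 2 * (x ^+ 2 + u ^+ 2) <= L ^+ 4 * (3 * (c ^+ 2 + u ^+ 2)).
  rewrite mulrDr; have := mulr_ge0 (le_trans ler01 L4) c2.
  nra.
apply: (@le_trans _ _ (gam * (L ^+ 4 * (3 * (c ^+ 2 + u ^+ 2))))).
  rewrite [leLHS](_ : _ = gam * ((1 - a) ^+ 2 * (x ^+ 2 + u ^+ 2))); last by ring.
  by rewrite ler_wpM2l // ltW.
have LL : 4 <= (1 + L) ^+ 2 by have := L1; clear; nra.
have gc : gam * c ^+ 2 <= c ^+ 2 by rewrite ler_piMl // ltW.
have E4 : 0 <= L ^+ 4 by apply: le_trans L4.
have : gam * (3 * (c ^+ 2 + u ^+ 2)) <= (c ^+ 2 + gam * u ^+ 2) * (2 * (1 + L) ^+ 2).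
  have := mulr_ge0 (ltW g0) u2; nra.
move=> /(ler_wpM2l E4) h; apply: le_trans (le_trans h _); rewrite le_eqVlt; apply/orP; left; apply/eqP; ring.
Qed.

Section KKT.
Variables (F : realType) (n m T : nat).
Variables (A : 'M[F]_n) (B : 'M[F]_(n, m)) (Q : 'M[F]_n) (R : 'M[F]_m).

(** Coupling within one time step; [kkt1] couples the state and control of a step with the
    multiplier of the next one. Using [kkt1] and its transpose with opposite shifts makes the
    operator symmetric. *)
Definition kkt0 : 'M[F]_(n + m + n) :=
  block_mx (block_mx Q 0 0 R) (col_mx (- 1%:M) 0) (row_mx (- 1%:M) 0) 0.

Definition kkt1 : 'M[F]_(n + m + n) := block_mx 0 (col_mx A^T B^T) 0 0.

(* The first-order optimality system of the finite-horizon problem; the rows of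
   the unknown are the state, the control and the multiplier of the dynamics. *)
Definition kkt (Z : 'M[F]_(n + m + n, T)) : 'M[F]_(n + m + n, T) :=
  kkt0 *m Z + kkt1 *m Z *m (shiftmx F T)^T + kkt1^T *m Z *m shiftmx F T.

(** The rows are the adjoint equation, stationarity in the control and the dynamics. At time 0 the
    last row is -x(0), so the initial state is data; past the last step the multiplier counts as
    0. *)
Lemma kktE (X : 'M[F]_(n, T)) (U : 'M[F]_(m, T)) (Y : 'M[F]_(n, T)) :
  kkt (col_mx (col_mx X U) Y) =
  col_mx (col_mx (Q *m X + (A^T *m Y *m (shiftmx F T)^T - Y))
                 (R *m U + B^T *m Y *m (shiftmx F T)^T))
         ((A *m X + B *m U) *m shiftmx F T - X).
Proof.
rewrite /kkt /kkt0 /kkt1 tr_block_mx !trmx0 tr_col_mx !trmxK.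
rewrite !mul_block_col !mul_row_col !mul_col_mx !mul0mx ?add0r ?addr0.
rewrite -!col_mx0 !mulNmx !mul1mx ?mul_col_mx ?add_col_mx ?mul0mx ?addr0 ?add0r.
rewrite (addrC (- X)) -addrA (addrC (- Y)).
by apply: (f_equal2 (@col_mx _ _ _ _)); first apply: (f_equal2 (@col_mx _ _ _ _)).
Qed.

Lemma kktD (Z W : 'M[F]_(n + m + n, T)) : kkt (Z + W) = kkt Z + kkt W.
Proof. by rewrite /kkt !mulmxDr !mulmxDl (addrACA (kkt0 *m Z)) (addrACA (_ + _)). Qed.

Lemma kktZ c (Z : 'M[F]_(n + m + n, T)) : kkt (c *: Z) = c *: kkt Z.
Proof. by rewrite /kkt -!scalemxAr -!scalemxAl -!scalerDr. Qed.

Hypotheses (QT : Q^T = Q) (RT : R^T = R).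

Lemma kkt_sym (Z W : 'M[F]_(n + m + n, T)) : fip (kkt Z) W = fip Z (kkt W).
Proof.
have M0T : kkt0^T = kkt0.
  rewrite /kkt0 tr_block_mx tr_block_mx tr_col_mx tr_row_mx !trmx0 QT RT.
  by rewrite linearN /= trmx1.
rewrite /kkt !fipDl !fipDr !(fip_mulr _ (_ *m Z)) !fip_mull trmxK M0T trmxK !mulmxA addrAC //.
Qed.

Variables (L : F).
Hypotheses (L0 : 0 <= L).
Hypotheses (hA : opbound A L) (hB : opbound B L) (hQ : opbound Q L) (hR : opbound R L).

(** The row norms are bounded by a symmetric nonnegative 3x3 matrix applied to (|X|, |U|, |Y|); 2L +
    1 is its largest row sum. *)
Lemma kkt_upper (Z : 'M[F]_(n + m + n, T)) : fnorm (kkt Z) <= (2 * L + 1) * fnorm Z.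
Proof.
rewrite -(vsubmxK Z) -(vsubmxK (usubmx Z)).
move: (dsubmx Z) (usubmx (usubmx Z)) (dsubmx (usubmx Z)) => Y X U.
have L1 : 0 <= 2 * L + 1 by rewrite addr_ge0 ?mulr_ge0.
rewrite -(ler_pXn2r (ltn0Sn 1)) ?nnegrE ?mulr_ge0 // exprMn kktE !fnorm_col_mx.
set f := _ + (_ - _); set g := R *m U + _; set h := _ - X.
have fle : fnorm f <= L * fnorm X + (L + 1) * fnorm Y.
  apply: (le_trans (fnormD _ _)); apply: lerD; first exact: fnorm_mull.
  apply: (le_trans (fnormB _ _)); rewrite mulrDl mul1r lerD2r.
  by apply: (le_trans (fnorm_shiftT _)); apply: fnorm_mull => //; apply: opbound_tr.
have gle : fnorm g <= L * fnorm U + L * fnorm Y.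
  apply: (le_trans (fnormD _ _)); apply: lerD; first exact: fnorm_mull.
  by apply: (le_trans (fnorm_shiftT _)); apply: fnorm_mull => //; apply: opbound_tr.
have hle : fnorm h <= (L + 1) * fnorm X + L * fnorm U.
  apply: (le_trans (fnormB _ _)); rewrite mulrDl mul1r addrAC lerD2r.
  apply: (le_trans (fnorm_shift _)); apply: (le_trans (fnormD _ _)).
  by apply: lerD; apply: fnorm_mull.
have sq (a b : F) : 0 <= a -> a <= b -> a ^+ 2 <= b ^+ 2.
  by move=> a0 ab; rewrite ler_pXn2r ?nnegrE //; apply: le_trans ab.
have := sq _ _ (fnorm_ge0 f) fle; have := sq _ _ (fnorm_ge0 g) gle.
have := sq _ _ (fnorm_ge0 h) hle.
move: (fnorm X) (fnorm U) (fnorm Y) (fnorm f) (fnorm g) (fnorm h) => x u y p q r h1 h2 h3.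
have l1 := mulr_ge0 L0 L0.
(* Certificate for the row-sum bound: each squared difference is weighted below by the matching
   off-diagonal entry of the square of the 3x3 matrix, L^2 or L (L + 1). *)
have := sqr_ge0 (x - y); have := sqr_ge0 (u - y); have := sqr_ge0 (x - u) => s1 s2 s3.
have L2 : 0 <= L * (L + 1) by rewrite mulr_ge0 ?addr_ge0.
have t1 := mulr_ge0 l1 s2; have t2 := mulr_ge0 L2 s3; have t3 := mulr_ge0 L2 s1.
have u2 : 0 <= u ^+ 2 := sqr_ge0 u; have y2 : 0 <= y ^+ 2 := sqr_ge0 y.
have v1 := mulr_ge0 L0 u2; have v2 := mulr_ge0 L0 y2.
have v3 := mulr_ge0 l1 u2; have v4 := mulr_ge0 l1 y2.
nra.
Qed.

Variables (a gam : F) (C : 'M[F]_n).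
Hypotheses (L1 : 1 < L) (a0 : 0 < a) (a1 : a < 1) (g0 : 0 < gam) (g1 : gam < 1).
Hypotheses (hRg : psdmx_ge R gam%:M) (stab : stabilizable L a A B).
Hypotheses (CT : C^T = C) (CC : C *m C = Q) (det : detectable L a A C).

Local Notation phi := (steering_gain L a).

(** Under the stabilizing feedback the dynamics operator is invertible by a Neumann sum. This is a
    right inverse of the constraint, bounded uniformly in [T]. *)
Lemma dynamics_solve (H : 'M[F]_(n, T)) : exists X : 'M[F]_(n, T), exists U : 'M[F]_(m, T),
  (A *m X + B *m U) *m shiftmx F T - X = H /\ fnorm X + fnorm U <= phi * fnorm H.
Proof.
have [K [hK st]] := stab.
have [X eX nX] := stable_solve L0 (ltW a0) a1 st H.
exists X, (- (K *m X)); split; first by rewrite -eX mulmxBl mulmxN mulmxA.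
rewrite fnormN; have := fnorm_mull X L0 (opbound_mxnorm2 hK) => nK.
have -> : phi = (1 + L) * (L / (1 - a)) by rewrite /steering_gain mulrCA mulrA.
rewrite -mulrA; apply: le_trans (ler_wpM2l _ nX); last by rewrite addr_ge0.
by rewrite mulrDl mul1r lerD2l.
Qed.

Lemma psd_fip_ge (U : 'M[F]_(m, T)) : gam * fnorm U ^+ 2 <= fip U (R *m U).
Proof.
have [_ h] := hRg; rewrite fnorm_sqr -subr_ge0 -fipZr -fipNr -fipDr.
have -> : R *m U - gam *: U = (R - gam%:M) *m U by rewrite mulmxBl mul_scalar_mx.
rewrite fip_sum_col; apply: sumr_ge0 => t _.
by rewrite (colE t (_ *m _)) -mulmxA -colE -quadfE.
Qed.

(** On the kernel of the constraint, detectability bounds X by C X and U, and both are seen by the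
    cost because |C X|^2 = <X, Q X>. *)
Lemma reduced_hessian_coercive (X : 'M[F]_(n, T)) (U : 'M[F]_(m, T)) :
  (A *m X + B *m U) *m shiftmx F T - X = 0 ->
  gammaG L a gam * (fnorm X ^+ 2 + fnorm U ^+ 2) <= fip X (Q *m X) + fip U (R *m U).
Proof.
move=> e; have := detectable_bound X U L0 (ltW a0) a1 hB det.
rewrite e fnorm0 add0r.
have <- : fnorm (C *m X) ^+ 2 = fip X (Q *m X).
  by rewrite fnorm_sqr fip_mull CT mulmxA CC.
move=> hx; apply: le_trans (lerD (lexx _) (psd_fip_ge U)).
move: (fnorm_ge0 X) (fnorm_ge0 U) (fnorm_ge0 (C *m X)) hx.
move: (fnorm X) (fnorm U) (fnorm (C *m X)) => x u c x0 u0 c0 hx.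
exact: gammaG_arith.
Qed.

(** Saddle-point stability: surjectivity of the constraint and coercivity on its kernel. The
    constant [p] bounds the state and control, as a particular solution ([phi]) plus a kernel part;
    [phi * (1 + L * p)] bounds the multiplier. *)
Lemma kkt_lower (Z : 'M[F]_(n + m + n, T)) :
  let p := phi + (1 + L * phi) / gammaG L a gam in
  fnorm Z <= (p + phi * (1 + L * p)) * fnorm (kkt Z).
Proof.
rewrite /=; set p := phi + _; rewrite -(vsubmxK Z) -(vsubmxK (usubmx Z)).
move: (dsubmx Z) (usubmx (usubmx Z)) (dsubmx (usubmx Z)) => Y X U {Z}.
have d0 : 0 < 1 - a by rewrite subr_gt0.
have Lp : 0 < L := lt_trans ltr01 L1.
have phi0 : 0 < phi by rewrite /steering_gain divr_gt0 ?mulr_gt0 // addr_gt0.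
have G0 : 0 < gammaG L a gam.
  by rewrite /gammaG !(mulr_gt0, invr_gt0, exprn_gt0) // addr_gt0.
have phi0' := ltW phi0.
have K0 : 0 <= (1 + L * phi) / gammaG L a gam.
  by rewrite divr_ge0 ?(ltW G0) // addr_ge0 // mulr_ge0.
have p0 : 0 <= p by rewrite addr_ge0.
have pp0 : 0 <= phi * (1 + L * p) by rewrite mulr_ge0 // addr_ge0 // mulr_ge0.
set s := fnorm (kkt _).
have es := erefl s; rewrite {2}/s kktE in es; move: es.
set f := _ + (_ - _); set g := R *m U + _; set h := _ - X => es.
have sf : fnorm (col_mx f g) <= s by rewrite es fnorm_col_mx_u.
have sh : fnorm h <= s by rewrite es fnorm_col_mx_d.
have s0 : 0 <= s by exact: fnorm_ge0.
have [Xr [Ur [eh nr]]] := dynamics_solve h.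
pose Xn := X - Xr; pose Un := U - Ur.
have en : (A *m Xn + B *m Un) *m shiftmx F T - Xn = 0.
  rewrite /Xn /Un !mulmxBr addrACA -opprD mulmxBl opprB (addrC Xr) addrACA.
  by rewrite (addrC (- _) Xr) -(opprB _ Xr) eh subrr.
have nrs : fnorm Xr + fnorm Ur <= phi * s by apply: (le_trans nr); rewrite ler_wpM2l // ltW.
(* The first two rows tested against any pair: the multiplier meets only the dynamics residual of
   that pair, hence disappears when the pair lies in the kernel. *)
have adj (X' : 'M[F]_(n, T)) (U' : 'M[F]_(m, T)) :
  fip (col_mx X' U') (col_mx f g) = fip X' (Q *m X) + fip U' (R *m U)
     + fip ((A *m X' + B *m U') *m shiftmx F T - X') Y.
  rewrite fip_col_mx /f /g !fipDr fipNr mulmxDl !fipDl fipNl !(fip_mulr (shiftmx F T)) !fip_mull !mulmxA.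
  ring.
have pn : fnorm (col_mx Xn Un) <= (1 + L * phi) / gammaG L a gam * s.
  have [->|nz] := eqVneq (fnorm (col_mx Xn Un)) 0.
    by rewrite mulr_ge0.
  have np : 0 < fnorm (col_mx Xn Un) by rewrite lt_neqAle eq_sym nz fnorm_ge0.
  rewrite mulrAC ler_pdivlMr // -(ler_pM2r np) mulrAC -expr2 mulrC fnorm_col_mx.
  apply: (le_trans (reduced_hessian_coercive en)).
  have eq1 : fip Xn (Q *m Xn) + fip Un (R *m Un) =
     fip (col_mx Xn Un) (col_mx f g) - fip Xn (Q *m Xr) - fip Un (R *m Ur).
    rewrite adj en [fip 0 _]fipC fip0r {2}/Xn {2}/Un !mulmxBr !fipDr !fipNr; ring.
  rewrite eq1.
  have b1 : fip (col_mx Xn Un) (col_mx f g) <= fnorm (col_mx Xn Un) * s.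
    by apply: (le_trans (fip_le _ _)); rewrite ler_wpM2l.
  have b2 : - fip Xn (Q *m Xr) <= fnorm (col_mx Xn Un) * (L * fnorm Xr).
    rewrite -fipNr; apply: (le_trans (fip_le _ _)); rewrite fnormN.
    apply: ler_pM => //; [exact: fnorm_col_mx_u | exact: fnorm_mull].
  have b3 : - fip Un (R *m Ur) <= fnorm (col_mx Xn Un) * (L * fnorm Ur).
    rewrite -fipNr; apply: (le_trans (fip_le _ _)); rewrite fnormN.
    apply: ler_pM => //; [exact: fnorm_col_mx_d | exact: fnorm_mull].
  apply: (le_trans (lerD (lerD b1 b2) b3)).
  rewrite -!mulrDr mulrC ler_wpM2r //.
  by rewrite mulrDl mul1r -addrA -mulrDr lerD2l -mulrA ler_wpM2l.
have pP : fnorm (col_mx X U) <= p * s.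
  have -> : col_mx X U = col_mx Xr Ur + col_mx Xn Un.
    by rewrite add_col_mx /Xn /Un !(addrC _ (_ - _)) !subrK.
  apply: (le_trans (fnormD _ _)); rewrite /p mulrDl; apply: lerD => //.
  exact: le_trans (fnorm_col_mx_le _ _) nrs.
have YP : fnorm Y <= phi * (1 + L * p) * s.
  have [->|nz] := eqVneq (fnorm Y) 0.
    by rewrite mulr_ge0.
  have np : 0 < fnorm Y by rewrite lt_neqAle eq_sym nz fnorm_ge0.
  rewrite -(ler_pM2r np) -expr2 fnorm_sqr.
  (* A test pair whose residual is Y itself turns the multiplier term into |Y|^2. *)
  have [Xq [Uq [eq nq]]] := dynamics_solve Y.
  have := adj Xq Uq; rewrite eq => /esym /(canRL (addKr _)) ->.
  have c0 : fnorm (col_mx Xq Uq) <= phi * fnorm Y.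
    exact: le_trans (fnorm_col_mx_le _ _) nq.
  have b1 : fip (col_mx Xq Uq) (col_mx f g) <= phi * fnorm Y * s.
    by apply: (le_trans (fip_le _ _)); apply: ler_pM.
  have b2 : - fip Xq (Q *m X) <= fnorm Xq * (L * (p * s)).
    rewrite -fipNr; apply: (le_trans (fip_le _ _)); rewrite fnormN ler_wpM2l //.
    apply: (le_trans (fnorm_mull _ L0 hQ)); rewrite ler_wpM2l //.
    exact: le_trans (fnorm_col_mx_u _ _) pP.
  have b3 : - fip Uq (R *m U) <= fnorm Uq * (L * (p * s)).
    rewrite -fipNr; apply: (le_trans (fip_le _ _)); rewrite fnormN ler_wpM2l //.
    apply: (le_trans (fnorm_mull _ L0 hR)); rewrite ler_wpM2l //.
    exact: le_trans (fnorm_col_mx_d _ _) pP.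
  have Lps0 : 0 <= L * (p * s) by rewrite !mulr_ge0.
  have := ler_wpM2r Lps0 nq; lra.
apply: (le_trans (fnorm_col_mx_le _ _)); rewrite mulrDl; exact: lerD.
Qed.

End KKT.

(** * Constants and the Richardson iteration *)

Section ConstantBounds.
Variables (F : realType) (L a gam : F).
Hypotheses (L1 : 1 < L) (a01 : 0 < a < 1) (g01 : 0 < gam < 1).

Lemma gammaG_gt0 : 0 < gammaG L a gam.
Proof.
have [/andP[a0 a1] /andP[g0 g1]] := (a01, g01); have Lp := lt_trans ltr01 L1.
by rewrite /gammaG divr_gt0 ?mulr_gt0 ?exprn_gt0 // ?subr_gt0 // ?addr_gt0.
Qed.

Lemma steering_gain_ge1 : 1 <= steering_gain L a.
Proof.
have [/andP[a0 a1] L1'] := (a01, L1); rewrite /steering_gain ler_pdivlMr ?subr_gt0 //.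
nra.
Qed.

Lemma gammaFE : (gammaF L a)^-1 = steering_gain L a ^+ 2.
Proof.
have [/andP[a0 a1] L1'] := (a01, L1).
by rewrite /gammaF /steering_gain invf_div expr_div_n exprMn.
Qed.

Lemma constLH_ge : 2 * L + 1 <= constLH L a.
Proof. by rewrite /constLH le_max lexx. Qed.

(** As [mubar >= 0], a comparison with (1 + 4H/G) H phi^2 suffices. From H >= 2L + 1 and phi >= 1
    follow 2 phi + L phi^2 <= H phi^2 and 1 + L phi <= H phi. The first inequality feeds the
    saddle-point bound into [gammaH], the second gives [gammaH <= 1]. *)
Lemma gammaH_inv_ge :
  let p := steering_gain L a + (1 + L * steering_gain L a) / gammaG L a gam in
  p + steering_gain L a * (1 + L * p) <= (gammaH L a gam)^-1
  /\ 1 <= (gammaH L a gam)^-1.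
Proof.
move: gammaG_gt0 steering_gain_ge1 constLH_ge gammaFE L1 => G0 phi1 HL eF L1'.
have Lp := lt_trans ltr01 L1'.
rewrite /gammaH invrK /=.
have H0' : 0 <= constLH L a.
  by apply: le_trans HL; rewrite addr_ge0 ?mulr_ge0 // ltW.
have mu0 : 0 <= mubar L a gam.
  rewrite /mubar eF; move: G0 H0'.
  move: (gammaG _ _ _) (constLH _ _) => G H G0 H0'.
  by rewrite mulr_ge0 ?sqr_ge0 // !addr_ge0 ?(ltW G0) // mulr_ge0 ?mulr_ge0 ?sqr_ge0 // invr_ge0 ltW.
rewrite eF.
move: G0 phi1 HL mu0 {H0'}.
move: (gammaG L a gam) (steering_gain L a) (constLH L a) (mubar L a gam) => G phi H mu.
move=> G0 phi1 HL mu0 {eF}.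
have phi0 : 0 <= phi by apply: le_trans phi1.
have H0 : 0 <= H by lra.
have i0 : 0 <= G^-1 by rewrite invr_ge0 ltW.
have s1 : H * phi ^+ 2 <= H * (1 + mu * H) * phi ^+ 2.
  by rewrite ler_wpM2r ?sqr_ge0 // ler_peMr // lerDl mulr_ge0.
have s2 : (1 + 4 * H / G) * (H * phi ^+ 2) <=
   (1 + 4 * H / G + 4 * H ^+ 2 / G ^+ 2) * (H * (1 + mu * H) * phi ^+ 2).
  apply: ler_pM => //; last by rewrite lerDl !mulr_ge0 ?invr_ge0 ?sqr_ge0.
    by rewrite addr_ge0 ?mulr_ge0.
  by rewrite mulr_ge0 ?sqr_ge0.
have s3 : 2 * phi + L * phi ^+ 2 <= H * phi ^+ 2.
  have := ler_wpM2r (sqr_ge0 phi) HL; nra.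
have s4 : (1 + L * phi) ^+ 2 <= (H * phi) ^+ 2.
  rewrite ler_pXn2r ?nnegrE ?addr_ge0 ?mulr_ge0 ?ltW //; nra.
have s5 : (1 + L * phi) ^+ 2 / G <= 4 * H / G * (H * phi ^+ 2).
  have := ler_wpM2r i0 s4; have : 0 <= (H * phi) ^+ 2 / G by rewrite mulr_ge0 ?sqr_ge0.
  have -> : 4 * H / G * (H * phi ^+ 2) = 4 * ((H * phi) ^+ 2 / G) by ring.
  lra.
have s6 : 0 <= 2 / G by rewrite mulr_ge0.
split.
  have -> : phi + (1 + L * phi) / G + phi * (1 + L * (phi + (1 + L * phi) / G)) =
    2 * phi + L * phi ^+ 2 + (1 + L * phi) ^+ 2 / G by ring.
  have : (1 + 4 * H / G) * (H * phi ^+ 2) = H * phi ^+ 2 + 4 * H / G * (H * phi ^+ 2) by ring.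
  rewrite -mulrA; move: s2; rewrite -mulrA.
  lra.
apply: (@le_trans _ _ ((1 + 4 * H / G) * (H * phi ^+ 2))).
  have e1 : 1 <= H * phi ^+ 2.
    have : 1 <= phi ^+ 2 by rewrite exprn_ege1.
    nra.
  have e2 : 0 <= 4 * H / G * (H * phi ^+ 2) by rewrite !mulr_ge0 ?sqr_ge0.
  by rewrite mulrDl mul1r (le_trans e1) // lerDl.
lra.
Qed.

Lemma gammaH_gt0 : 0 < gammaH L a gam.
Proof.
have [_ h] := gammaH_inv_ge.
by rewrite -invr_gt0 (lt_le_trans ltr01).
Qed.

Lemma gammaH_le1 : gammaH L a gam <= 1.
Proof.
have [_ h] := gammaH_inv_ge; have g0 := gammaH_gt0.
by rewrite -[leLHS]invrK invf_le1 // invr_gt0.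
Qed.

Lemma constLH_gt1 : 1 < constLH L a.
Proof. by have := constLH_ge; have := L1; lra. Qed.

Lemma rho_sqr : rho L a gam ^+ 2 =
  (constLH L a ^+ 2 - gammaH L a gam ^+ 2) / (constLH L a ^+ 2 + gammaH L a gam ^+ 2).
Proof.
have [[g0 gl] h1] := (gammaH_gt0, gammaH_le1, constLH_gt1).
have H0 := lt_trans ltr01 h1.
rewrite sqr_sqrtr //; apply: divr_ge0; last by rewrite addr_ge0 ?sqr_ge0.
by rewrite subr_ge0 ler_pXn2r ?nnegrE ?ltW // (le_lt_trans gl).
Qed.

Lemma rho_bounds : 0 < rho L a gam < 1.
Proof.
have [[g0 gl] h1] := (gammaH_gt0, gammaH_le1, constLH_gt1).
have H0 := lt_trans ltr01 h1.
have gH := le_lt_trans gl h1.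
have D0 : 0 < constLH L a ^+ 2 + gammaH L a gam ^+ 2 by rewrite addr_gt0 ?exprn_gt0.
have r0 : 0 < rho L a gam.
  rewrite sqrtr_gt0 divr_gt0 // subr_gt0.
  by rewrite ltr_pXn2r ?nnegrE ?ltW.
rewrite r0 -(ltr_pXn2r (ltn0Sn 1)) ?nnegrE ?ltW // rho_sqr expr1n ltr_pdivrMr // mul1r.
have := exprn_gt0 2 g0; lra.
Qed.

Lemma Upsilon_ge1 : 1 <= Upsilon L a gam.
Proof.
have [[g0 gl] h1] := (gammaH_gt0, gammaH_le1, constLH_gt1).
have /andP[r0 r1] := rho_bounds.
rewrite /Upsilon ler_pdivlMr ?mulr_gt0 ?exprn_gt0 // mul1r.
apply: le_trans (ltW h1); rewrite mulr_ile1 ?exprn_ile1 // ?ltW // exprn_gt0 //.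
Qed.

End ConstantBounds.

Section Richardson.
Variables (F : realType) (d T : nat) (f : 'M[F]_(d, T) -> 'M[F]_(d, T)) (lo up : F).
Hypotheses (fD : forall Z W, f (Z + W) = f Z + f W) (fZ : forall c Z, f (c *: Z) = c *: f Z).
Hypotheses (fsym : forall Z W, fip (f Z) W = fip Z (f W)).
Hypotheses (lo0 : 0 < lo) (lu : lo < up).
Hypotheses (flo : forall Z, lo * fnorm Z <= fnorm (f Z)).
Hypotheses (fup : forall Z, fnorm (f Z) <= up * fnorm Z).

(* Richardson's iteration for the normal equations with the optimal step. It is
   a contraction because [lo^2 <= f^2 <= up^2]; instead of diagonalising, the
   bound [|t Z|^2 <= (up^2 - lo^2) <t Z, Z>] for [t = f^2 - lo^2] is obtained
   from Cauchy-Schwarz for the form of [t]. *)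
Lemma richardson_contraction (Z : 'M[F]_(d, T)) :
  fnorm (Z - (2 / (lo ^+ 2 + up ^+ 2)) *: f (f Z)) <=
  (up ^+ 2 - lo ^+ 2) / (up ^+ 2 + lo ^+ 2) * fnorm Z.
Proof.
have up0 : 0 < up := lt_trans lo0 lu.
have c0 : 0 < up ^+ 2 - lo ^+ 2 by rewrite subr_gt0 ltr_pXn2r ?nnegrE ?ltW.
have D0 : 0 < up ^+ 2 + lo ^+ 2 by rewrite addr_gt0 ?exprn_gt0.
pose t W := f (f W) - lo ^+ 2 *: W.
have et W : t W = f (f W) - lo ^+ 2 *: W by [].
clearbody t.
have tq W : fip (t W) W = fnorm (f W) ^+ 2 - lo ^+ 2 * fnorm W ^+ 2.
  by rewrite !et fipDl fipNl fipZl fsym !fnorm_sqr.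
have tge W : 0 <= fip (t W) W.
  rewrite tq subr_ge0 -exprMn ler_pXn2r ?nnegrE ?mulr_ge0 // ltW //.
have tle W : fip (t W) W <= (up ^+ 2 - lo ^+ 2) * fnorm W ^+ 2.
  rewrite tq mulrBl lerD2r -exprMn ler_pXn2r ?nnegrE ?mulr_ge0 // ltW //.
have tsym V W : fip (t V) W = fip V (t W).
  by rewrite !et fipDl fipDr fipNl fipNr fipZl fipZr !fsym.
have tD V W : t (V + W) = t V + t W.
  by rewrite !et !fD scalerDr opprD addrACA.
have tZ k W : t (k *: W) = k *: t W.
  by rewrite !et !fZ scalerBr !scalerA mulrC.
have cs V W : fip (t V) W ^+ 2 <= fip (t V) V * fip (t W) W.
  apply: quad_discr => k; have := tge (V + k *: W).
  rewrite tD tZ !fipDl !fipDr !fipZl !fipZr (tsym W V) (fipC W); congr (_ <= _); ring.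
have key : fnorm (t Z) ^+ 2 <= (up ^+ 2 - lo ^+ 2) * fip (t Z) Z.
  have [->|nz] := eqVneq (fnorm (t Z) ^+ 2) 0; first by rewrite mulr_ge0 // ltW.
  have np : 0 < fnorm (t Z) ^+ 2 by rewrite lt_neqAle eq_sym nz sqr_ge0.
  rewrite -(ler_pM2r np) -expr2 {1}fnorm_sqr; apply: (le_trans (cs _ _)).
  by rewrite mulrAC mulrC ler_wpM2r.
set w := 2 / _; set r := _ / _.
have r0 : 0 <= r by rewrite divr_ge0 ?ltW.
(* With this step size the map is r - w t, and [key] bounds w^2 |t Z|^2 by 2 w r <t Z, Z>, exactly
   the cross term of the expanded square. *)
have er : 1 - w * lo ^+ 2 = r.
  by rewrite /w /r; field; rewrite gt_eqF // addrC.
have ew : w * (up ^+ 2 - lo ^+ 2) = 2 * r.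
  by rewrite /w /r (addrC (lo ^+ 2)); ring.
have w0 : 0 <= w by rewrite divr_ge0 // addrC ltW.
have -> : Z - w *: f (f Z) = r *: Z - w *: t Z.
  by rewrite -er et scalerBl scalerBr scale1r scalerA opprB addrA subrK.
have expand : fnorm (r *: Z - w *: t Z) ^+ 2 =
  r ^+ 2 * fnorm Z ^+ 2 - 2 * w * r * fip (t Z) Z + w ^+ 2 * fnorm (t Z) ^+ 2.
  rewrite fnorm_sqr fipDl !fipDr !fipNl !fipNr !fipZl !fipZr (fipC Z (t Z)) -!fnorm_sqr.
  ring.
rewrite -(ler_pXn2r (ltn0Sn 1)) ?nnegrE ?(mulr_ge0 r0) // exprMn expand.
have := ler_wpM2l (sqr_ge0 w) key.
have -> : w ^+ 2 * ((up ^+ 2 - lo ^+ 2) * fip (t Z) Z) = w * (w * (up ^+ 2 - lo ^+ 2)) * fip (t Z) Z by ring.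
rewrite ew => h.
lra.
Qed.

Fixpoint richardson (b : 'M[F]_(d, T)) (k : nat) : 'M[F]_(d, T) :=
  if k is k'.+1
  then richardson b k' + (2 / (lo ^+ 2 + up ^+ 2)) *: f (b - f (richardson b k'))
  else 0.

(** The residual enters each step as w f(r) and earlier contributions do not grow. The linear factor
    k is harmless: r becomes small while k stays fixed. *)
Lemma richardson_error (b z r : 'M[F]_(d, T)) k : f z = b + r ->
  fnorm (richardson b k - z) <=
  ((up ^+ 2 - lo ^+ 2) / (up ^+ 2 + lo ^+ 2)) ^+ k * fnorm z
  + k%:R * (2 / (lo ^+ 2 + up ^+ 2) * up * fnorm r).
Proof.
move=> e; set w := 2 / _; set q := _ / _.
have up0 : 0 < up := lt_trans lo0 lu.
have w0 : 0 <= w by rewrite divr_ge0 // addr_ge0 // sqr_ge0.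
have q0 : 0 <= q.
  apply: divr_ge0; last by rewrite addr_ge0 ?sqr_ge0.
  by rewrite subr_ge0 ler_pXn2r ?nnegrE ?ltW.
have q1 : q <= 1.
  rewrite ler_pdivrMr ?addr_gt0 ?exprn_gt0 // mul1r.
  by have := sqr_ge0 lo; lra.
elim: k => [|k ih]; first by rewrite /= sub0r fnormN expr0 !mul1r mul0r addr0.
have fN W : f (- W) = - f W by rewrite -scaleN1r fZ scaleN1r.
have -> : richardson b k.+1 - z =
  ((richardson b k - z) - w *: f (f (richardson b k - z))) - w *: f r.
  rewrite /= -/w; move: (richardson b k) => y.
  have -> : b - f y = - f (y - z) - r by rewrite fD fN e opprD opprK [- f y + _]addrC addrAC addrK.
  by rewrite (fD (- _)) (fN (f _)) (fN r) scalerDr !scalerN addrA [LHS]addrAC (addrAC y (- z)).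
have h1 := richardson_contraction (richardson b k - z).
have h2 : fnorm (w *: f r) <= w * up * fnorm r.
  by rewrite fnormZ ger0_norm // -mulrA ler_wpM2l.
apply: (le_trans (fnormB _ _)); apply: (le_trans (lerD h1 h2)).
have := ler_wpM2l q0 ih.
have k0 : 0 <= k%:R * (w * up * fnorm r) :=
  mulr_ge0 (ler0n _ _) (mulr_ge0 (mulr_ge0 w0 (ltW up0)) (fnorm_ge0 r)).
have := ler_piMl k0 q1.
rewrite -/q exprS -natr1; move: (w * up * fnorm r) (fnorm (_ - _)) (fnorm z) => E x y.
move: (q ^+ k) => qk; move: (k%:R : F) => kR; lra.
Qed.

End Richardson.

(** * Costate of the optimal regulator *)

(** Otherwise the partial sums eventually grow by [e] at every step. One small term beyond any given
    time is all that the choice of a horizon asks for. *)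
Lemma bounded_sum_term_small (F : realType) (c : nat -> F) (M e : F) :
  (forall T, \sum_(t < T) c t <= M) -> 0 < e -> forall t0, exists2 t, (t0 <= t)%N & c t < e.
Proof.
move=> h e0 t0; apply: contrapT => H.
have ge t : (t0 <= t)%N -> e <= c t.
  by move=> ht; rewrite leNgt; apply/negP => lt; apply: H; exists t.
have grow k : \sum_(t < t0) c t + k%:R * e <= \sum_(t < t0 + k) c t.
  elim: k => [|k ih]; first by rewrite mul0r addr0 addn0.
  rewrite addnS big_ord_recr /= -natr1 mulrDl mul1r addrA.
  by apply: lerD => //; apply: ge; rewrite leq_addr.
pose v := (M - \sum_(t < t0) c t) / e.
have ub k : k%:R <= `|v|.
  apply: le_trans (ler_norm _); rewrite ler_pdivlMr // lerBrDl.
  exact: le_trans (grow k) (h _).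
by have := archi_boundP (normr_ge0 v); rewrite ltNge ub.
Qed.

Section Optimality.
Variables (F : realType) (n m : nat).
Variables (A : 'M[F]_n) (B : 'M[F]_(n, m)) (Q : 'M[F]_n) (R : 'M[F]_m).
Implicit Types (x : nat -> 'cV[F]_n) (u : nat -> 'cV[F]_m).

Lemma feasible_residual (x0 : 'cV[F]_n) x u T : lqr_feasible A B x0 x u ->
  (A *m traj T x + B *m traj T u) *m shiftmx F T - traj T x
  = traj T (fun t => if t == 0%N then - x0 else 0).
Proof.
move=> [e0 e]; rewrite !mul_traj trajD traj_shift trajN trajD.
apply: eq_traj => -[|t] _ /=; first by rewrite sub0r e0.
by rewrite e subrr.
Qed.

Lemma fnorm_traj0 T (v : 'cV[F]_n) :
  fnorm (traj T (fun t => if t == 0%N then v else 0)) <= fnorm v.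
Proof.
case: T => [|T]; last by rewrite (@fnorm_traj1 _ _ _ _ 0%N) //; case.
by rewrite /fnorm fip_traj big_ord0 sqrtr0.
Qed.

Lemma closed_loop_feasible (K : 'M[F]_(m, n)) (x0 : 'cV[F]_n) :
  lqr_feasible A B x0 (fun t => (A - B *m K) ^+ t *m x0)
    (fun t => - (K *m ((A - B *m K) ^+ t *m x0))).
Proof.
split=> [|t]; first by rewrite expr0 mul1mx.
have -> : (A - B *m K) ^+ t.+1 *m x0 = (A - B *m K) *m ((A - B *m K) ^+ t *m x0) by rewrite exprS mulmxA.
by move: (_ ^+ t *m x0) => y; rewrite mulmxBl mulmxN mulmxA.
Qed.

Definition lqr_partial_cost x u T : F :=
  \sum_(t < T) (2^-1 * fip (x t) (Q *m x t) + 2^-1 * fip (u t) (R *m u t)).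

Lemma lqr_partial_costS x u T : lqr_partial_cost x u T.+1 = lqr_partial_cost x u T +
  (2^-1 * fip (x T) (Q *m x T) + 2^-1 * fip (u T) (R *m u T)).
Proof. exact: big_ord_recr. Qed.

Lemma lqr_partial_cost_Sl x u T : lqr_partial_cost x u T.+1 =
  2^-1 * fip (x 0%N) (Q *m x 0%N) + 2^-1 * fip (u 0%N) (R *m u 0%N)
  + lqr_partial_cost (fun t => x t.+1) (fun t => u t.+1) T.
Proof. exact: big_ord_recl. Qed.

Lemma lqr_partial_cost_traj x u T : lqr_partial_cost x u T =
  2^-1 * fip (traj T x) (Q *m traj T x) + 2^-1 * fip (traj T u) (R *m traj T u).
Proof. by rewrite !mul_traj !fip_traj !mulr_sumr -big_split. Qed.

Hypotheses (Q0 : forall x : 'cV[F]_n, 0 <= fip x (Q *m x)).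
Hypotheses (R0 : forall u : 'cV[F]_m, 0 <= fip u (R *m u)).

(** Nonnegative stage costs keep partial sums below the series. From here on optimality is an
    inequality between real partial sums. *)
Lemma optimal_partial_cost_le (x0 : 'cV[F]_n) x u x' u' M :
  lqr_optimal A B Q R x0 x u -> lqr_feasible A B x0 x' u' ->
  (forall T, lqr_partial_cost x' u' T <= M) -> forall T, lqr_partial_cost x u T <= M.
Proof.
have part y v T : (\sum_(0 <= t < T) (2^-1 * quadf Q (y t) + 2^-1 * quadf R (v t))%:E)%E
   = (lqr_partial_cost y v T)%:E.
  by rewrite sumEFin big_mkord; congr EFin; apply: eq_bigr => t _; rewrite !quadfE.
have nn (y : nat -> 'cV[F]_n) (v : nat -> 'cV[F]_m) t :
   (0 <= (2^-1 * quadf Q (y t) + 2^-1 * quadf R (v t))%:E)%E.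
  by rewrite lee_fin !quadfE addr_ge0 // mulr_ge0 // invr_ge0.
move=> [_ opt] fe hM T; rewrite -lee_fin -part.
have le1 : (lqr_cost Q R x' u' <= M%:E)%E.
  apply: lime_le; first by apply: is_cvg_nneseries => t _ _.
  by near=> k; rewrite part lee_fin.
apply: le_trans (le_trans (opt _ _ fe) le1).
by apply: nneseries_lim_ge => t _.
Unshelve. all: by end_near. Qed.

Variables (L a gam : F) (C : 'M[F]_n).
Hypotheses (L1 : 1 < L) (a0 : 0 < a) (a1 : a < 1) (g0 : 0 < gam).
Hypotheses (hB : opbound B L) (hQ : opbound Q L) (hR : opbound R L).
Hypotheses (hRg : psdmx_ge R gam%:M) (stab : stabilizable L a A B).
Hypotheses (CT : C^T = C) (CC : C *m C = Q) (det : detectable L a A C).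
Hypotheses (QT : Q^T = Q) (RT : R^T = R).

(** Optimality carries information only against a competitor of finite cost; the stabilizing
    feedback is one. *)
Lemma stabilizing_cost_bounded (x0 : 'cV[F]_n) : exists x u M,
  lqr_feasible A B x0 x u /\ forall T, lqr_partial_cost x u T <= M.
Proof.
have L0 : 0 <= L by apply: ltW; apply: lt_trans L1.
have [K [hK st]] := stab.
have fe := closed_loop_feasible K x0; set x := fun t => _ in fe; set u := fun t => _ in fe.
pose N := L / (1 - a) * fnorm x0.
have d0 : 0 <= 1 - a by rewrite subr_ge0 ltW.
have N0 : 0 <= N by rewrite !mulr_ge0 // invr_ge0.
exists x, u, (2^-1 * (N * (L * N)) + 2^-1 * (L * N * (L * (L * N)))); split => // T.
have eu : traj T u = - (K *m traj T x) by rewrite mul_traj trajN.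
have nx : fnorm (traj T x) <= N.
  apply: (le_trans (stable_bound L0 (ltW a0) a1 st (traj T x))).
  rewrite ler_wpM2l ?divr_ge0 //.
  have := feasible_residual T fe; rewrite eu mulmxN mulmxA -mulmxBl => ->.
  by rewrite -fnormN trajN; apply: le_trans (fnorm_traj0 T x0); rewrite le_eqVlt;
    apply/orP; left; apply/eqP; congr fnorm; apply: eq_traj => t _; case: ifP; rewrite ?opprK ?oppr0.
have nu : fnorm (traj T u) <= L * N.
  rewrite eu fnormN; apply: (le_trans (fnorm_mull _ L0 (opbound_mxnorm2 hK))).
  by rewrite ler_wpM2l.
rewrite lqr_partial_cost_traj; apply: lerD; rewrite ler_pM2l ?invr_gt0 //;
  apply: (le_trans (fip_le _ _)); apply: ler_pM => //.
  by apply: (le_trans (fnorm_mull _ L0 hQ)); rewrite ler_wpM2l.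
by apply: (le_trans (fnorm_mull _ L0 hR)); rewrite ler_wpM2l.
Qed.

Variables (K : 'M[F]_(m, n)).
Hypotheses (optK : lqr_optimal_gain A B Q R K).

Local Notation Phi := (A - B *m K).

Lemma closed_loop_optimal (x0 : 'cV[F]_n) : lqr_optimal A B Q R x0
  (fun t => Phi ^+ t *m x0) (fun t => - (K *m (Phi ^+ t *m x0))).
Proof. by apply: optK => //; apply: closed_loop_feasible. Qed.

Lemma closed_loop_square_summable (x0 : 'cV[F]_n) : exists N, forall T,
  \sum_(t < T) fnorm (Phi ^+ t *m x0) ^+ 2 <= N.
Proof.
have L0 : 0 <= L by apply: ltW; apply: lt_trans L1.
have [x' [u' [M [fe' hM]]]] := stabilizing_cost_bounded x0.
have cb := optimal_partial_cost_le (closed_loop_optimal x0) fe' hM.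
have fe := closed_loop_feasible K x0.
set x := fun t => _ in fe cb; set u := fun t => _ in fe cb.
have d0 : 0 <= 1 - a by rewrite subr_ge0 ltW.
(* From [detectable_bound], with |C X|^2 <= 2M and gam |U|^2 <= 2M; [sqle] replaces square roots. *)
pose N := L / (1 - a) * (fnorm x0 + L * (2 * M + 1) + L * (2 * M / gam + 1)).
have sqle (y v : F) : 0 <= y -> y ^+ 2 <= v -> y <= v + 1.
  move=> y0 yv; have := sqr_ge0 (y - 1); nra.
exists (N ^+ 2) => T.
have -> : \sum_(t < T) fnorm (Phi ^+ t *m x0) ^+ 2 = fnorm (traj T x) ^+ 2.
  by rewrite fnorm_sqr fip_traj; apply: eq_bigr => t _; rewrite fnorm_sqr.
rewrite -ler_sqrt ?sqr_ge0 // !sqrtr_sqr !ger0_norm //; last first.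
  have M0 : 0 <= M by have := cb 0%N; rewrite /lqr_partial_cost big_ord0.
  by rewrite /N mulr_ge0 ?divr_ge0 // !addr_ge0 // !mulr_ge0 // addr_ge0 // ?divr_ge0 ?mulr_ge0 // ltW.
apply: (le_trans (detectable_bound (traj T x) (traj T u) L0 (ltW a0) a1 hB det)).
rewrite ler_wpM2l ?divr_ge0 // (feasible_residual T fe).
have := cb T; rewrite lqr_partial_cost_traj.
have <- : fnorm (C *m traj T x) ^+ 2 = fip (traj T x) (Q *m traj T x).
  by rewrite fnorm_sqr fip_mull CT mulmxA CC.
have := psd_fip_ge hRg (traj T u) => hu hc.
have c2 := sqr_ge0 (fnorm (C *m traj T x)).
have gu2 : 0 <= gam * fnorm (traj T u) ^+ 2 by rewrite mulr_ge0 ?sqr_ge0 // ltW.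
apply: lerD; first apply: lerD.
- by apply: le_trans (fnorm_traj0 T (- x0)) _; rewrite fnormN.
- rewrite ler_wpM2l // sqle //; lra.
- rewrite ler_wpM2l // sqle // ler_pdivlMr // mulrC; lra.
Qed.

Lemma closed_loop_small (x0 : 'cV[F]_n) e : 0 < e -> forall t0, exists2 t, (t0 <= t)%N &
  fnorm (Phi ^+ t *m x0) < e.
Proof.
move=> e0 t0; have [N hN] := closed_loop_square_summable x0.
have [t ht lt] := @bounded_sum_term_small _ (fun t => fnorm (Phi ^+ t *m x0) ^+ 2) _ _
  hN (exprn_gt0 2 e0) t0.
by exists t => //; rewrite -(ltr_pXn2r (ltn0Sn 1)) ?nnegrE // ltW.
Qed.

Lemma closed_loop_bounded (x0 : 'cV[F]_n) : exists N, forall t, fnorm (Phi ^+ t *m x0) <= N.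
Proof.
have [N hN] := closed_loop_square_summable x0.
exists (N + 1) => t; have := hN t.+1; rewrite big_ord_recr /=.
have : 0 <= \sum_(i < t) fnorm (Phi ^+ i *m x0) ^+ 2.
  by apply: sumr_ge0 => i _; rewrite sqr_ge0.
have := sqr_ge0 (fnorm (Phi ^+ t *m x0) - 1); nra.
Qed.

Lemma closed_loop_quad_small (M : 'M[F]_n) (x : 'cV[F]_n) e : 0 < e ->
  exists t, `|fip (Phi ^+ t *m x) (M *m (Phi ^+ t *m x))| <= e.
Proof.
move=> e0; have c0 : 0 < fnorm M + 1 by rewrite ltr_wpDl.
pose d := Num.min 1 (e / (fnorm M + 1)).
have d0 : 0 < d by rewrite lt_min ltr01 divr_gt0.
have [t _ ht] := closed_loop_small x d0 0%N; exists t.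
have h2 : fnorm (Phi ^+ t *m x) <= 1 by apply: (le_trans (ltW ht)); rewrite ge_min lexx.
have h3 : fnorm (Phi ^+ t *m x) <= e / (fnorm M + 1).
  by apply: (le_trans (ltW ht)); rewrite ge_min lexx orbT.
move: (Phi ^+ t *m x) h2 h3 => y h2 h3 {ht}.
have h1 : fnorm y * fnorm (M *m y) <= e.
  apply: (@le_trans _ _ (1 * (fnorm M * (e / (fnorm M + 1))))).
    by apply: ler_pM => //; apply: (le_trans (opbound_fnorm _ _)); rewrite ler_wpM2l.
  rewrite mul1r mulrCA ler_piMr ?(ltW e0) // ler_pdivrMr // mul1r.
  by rewrite lerDl.
rewrite ler_norml lerNl -fipNl; apply/andP; split; apply: le_trans h1.
  by rewrite -(fnormN y); apply: fip_le.
exact: fip_le.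
Qed.

(** The map P -> P - Phi^T P Phi acts on a finite-dimensional space, so injectivity is enough. A
    kernel element equals (Phi^t)^T P Phi^t for all t, and closed-loop states are bounded and small
    at some late time. *)
Lemma lyapunov_solvable (W : 'M[F]_n) : exists P : 'M[F]_n, P = W + Phi^T *m P *m Phi.
Proof.
(* The matrix of that map acting on [mxvec P]. *)
pose M := 1%:M - lin_mulmx Phi^T *m lin_mulmxr Phi.
have ME P : mxvec P *m M = mxvec (P - Phi^T *m P *m Phi).
  by rewrite mulmxBr mulmx1 mulmxA !mul_vec_lin (linearB mxvec).
have rf : row_free M.
  apply: inj_row_free => v; rewrite -[v]vec_mxK; move: (vec_mx v) => P.
  rewrite ME => /eqP; rewrite mxvec_eq0 subr_eq0 => /eqP eP.
  have it t : P = (Phi ^+ t)^T *m P *m Phi ^+ t.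
    elim: t => [|t ih]; first by rewrite expr0 trmx1 mul1mx mulmx1.
    by rewrite {1}eP {1}ih exprSr trmx_mul !mulmxA.
  (* The one-sided bound suffices: with x a column of P it says that the squared norm of this column
     is at most 0. *)
  have z (x y : 'cV[F]_n) : fip x (P *m y) <= 0.
    apply/ler_addgt0Pl => e e0; rewrite addr0.
    have [N hN] := closed_loop_bounded x.
    have N0 : 0 <= N by apply: le_trans (hN 0%N).
    have c0 : 0 < N * fnorm P + 1 by rewrite ltr_wpDl // mulr_ge0.
    have [t _ ht] := closed_loop_small y (divr_gt0 e0 c0) 0%N.
    rewrite (it t) -!mulmxA -(fip_mull (Phi ^+ t)).
    apply: (le_trans (fip_le _ _)).
    have h1 := opbound_fnorm P (Phi ^+ t *m y).
    apply: (@le_trans _ _ (N * (fnorm P * (e / (N * fnorm P + 1))))).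
      apply: ler_pM => //; apply: (le_trans h1); rewrite ler_wpM2l // ltW //.
    rewrite mulrA mulrCA ler_piMr ?(ltW e0) // ler_pdivrMr // mul1r.
    by rewrite lerDl.
  apply/eqP; rewrite mxvec_eq0; apply/eqP; apply: fnorm_eq0; apply/eqP.
  rewrite -sqrf_eq0 fnorm_sqr fip_sum_col big1 // => t _.
  apply: le_anti; rewrite fip_ge0 andbT.
  by rewrite {2}colE; apply: z.
exists (vec_mx (mxvec W *m invmx M)).
have := ME (vec_mx (mxvec W *m invmx M)).
rewrite vec_mxK mulmxKV -?row_free_unit // => /(can_inj mxvecK); move: (vec_mx _) => P e.
by rewrite e subrK.
Qed.

(** P is the cost matrix of the closed loop. It is nonnegative because <x, P x> decreases along
    trajectories and comes arbitrarily close to 0. *)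
Lemma value_matrix : exists P : 'M[F]_n,
  [/\ P^T = P, P = (Q + K^T *m R *m K) + Phi^T *m P *m Phi
    & forall x : 'cV[F]_n, 0 <= fip x (P *m x)].
Proof.
have WT : (Q + K^T *m R *m K)^T = Q + K^T *m R *m K.
  by rewrite linearD /= QT !trmx_mul trmxK RT mulmxA.
have W0 (x : 'cV[F]_n) : 0 <= fip x ((Q + K^T *m R *m K) *m x).
  by rewrite mulmxDl fipDr addr_ge0 // -!mulmxA -fip_mull.
move: (Q + K^T *m R *m K) WT W0 => W WT W0.
have [P0 e0] := lyapunov_solvable W.
have e0T : P0^T = W + Phi^T *m P0^T *m Phi.
  by rewrite {1}e0 linearD /= WT !trmx_mul trmxK mulmxA.
(* The transpose of a solution is again a solution, so averaging gives a symmetric one. *)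
pose P := 2^-1 *: (P0 + P0^T).
have e : P = W + Phi^T *m P *m Phi.
  rewrite /P -scalemxAr -scalemxAl {1}e0 {1}e0T addrACA scalerDr (mulmxDr Phi^T) (mulmxDl (_ *m P0)).
  by congr (_ + _); rewrite -[W + W]mulr2n -(scaler_nat 2 W) scalerA mulVf ?pnatr_eq0 // scale1r.
exists P; split=> //.
  by rewrite /P linearZ /= linearD /= trmxK addrC.
have step (y : 'cV[F]_n) : fip y (P *m y) = fip y (W *m y) + fip (Phi *m y) (P *m (Phi *m y)).
  by rewrite {1}e (mulmxDl W) fipDr fip_mull !mulmxA.
have dec (x : 'cV[F]_n) t : fip (Phi ^+ t *m x) (P *m (Phi ^+ t *m x)) <= fip x (P *m x).
  elim: t => [|t ih]; first by rewrite expr0 mul1mx.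
  apply: le_trans ih; rewrite [leRHS]step exprS -(mulmxA Phi).
  by rewrite lerDr.
move=> x; apply/ler_addgt0Pl => e' e'0; rewrite -lerBlDl sub0r.
have [t] := closed_loop_quad_small P x e'0; rewrite ler_norml => /andP[small _].
exact: le_trans small (dec x t).
Qed.

(** One-step deviation: playing -K x + d at time 0 and the feedback afterwards costs a quadratic
    function of d that is minimal at d = 0, so its linear part vanishes. This is the second
    equation; it turns the Lyapunov equation into the first. *)
Lemma costate_equations : exists2 P : 'M[F]_n,
  P = Q + A^T *m P *m Phi & R *m K = B^T *m P *m Phi.
Proof.
have [P [PT eP P0]] := value_matrix.
have stepW (y : 'cV[F]_n) : fip y (P *m y) =
    fip y (Q *m y) + fip (K *m y) (R *m (K *m y)) + fip (Phi *m y) (P *m (Phi *m y)).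
  rewrite {1}eP (mulmxDl (_ + _)) (mulmxDl Q) !fipDr (fip_mull K) (fip_mull Phi).
  by rewrite !mulmxA.
have sumE (y : 'cV[F]_n) T :
    lqr_partial_cost (fun t => Phi ^+ t *m y) (fun t => - (K *m (Phi ^+ t *m y))) T =
    2^-1 * (fip y (P *m y) - fip (Phi ^+ T *m y) (P *m (Phi ^+ T *m y))).
  elim: T => [|T ih]; first by rewrite /lqr_partial_cost big_ord0 expr0 mul1mx subrr mulr0.
  rewrite lqr_partial_costS ih.
  rewrite mulmxN fipNl fipNr opprK exprS -(mulmxA Phi).
  by rewrite (stepW (Phi ^+ T *m y)); ring.
have key (x : 'cV[F]_n) (d : 'cV[F]_m) :
    fip x (P *m x) <= fip x (Q *m x) + fip (- (K *m x) + d) (R *m (- (K *m x) + d))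
      + fip (Phi *m x + B *m d) (P *m (Phi *m x + B *m d)).
  set v := - (K *m x) + d; set y := Phi *m x + B *m d.
  pose x' t := if t is t'.+1 then Phi ^+ t' *m y else x.
  pose u' t := if t is t'.+1 then - (K *m (Phi ^+ t' *m y)) else v.
  have fe : lqr_feasible A B x x' u'.
    split=> // -[|t].
      rewrite /x' /u' expr0 mul1mx /y /v mulmxDr addrA; congr (_ + _).
      by rewrite mulmxBl mulmxN mulmxA.
    exact: (closed_loop_feasible K y).2.
  have le' T : lqr_partial_cost x' u' T <=
      2^-1 * (fip x (Q *m x) + fip v (R *m v) + fip y (P *m y)).
    case: T => [|T]; first by rewrite /lqr_partial_cost big_ord0 mulr_ge0 ?addr_ge0 // invr_ge0.
    rewrite lqr_partial_cost_Sl.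
    by rewrite sumE; have := P0 (Phi ^+ T *m y); lra.
  have opt := optimal_partial_cost_le (closed_loop_optimal x) fe le'.
  apply/ler_addgt0Pr => e e0.
  have [t] := closed_loop_quad_small P x e0; rewrite ler_norml => /andP[_ small].
  have := opt t; rewrite sumE; lra.
have stat (x : 'cV[F]_n) : B^T *m P *m Phi *m x - R *m K *m x = 0.
  set w := _ - _.
  have h (d : 'cV[F]_m) : 0 <= 2 * fip d w + (fip d (R *m d) + fip (B *m d) (P *m (B *m d))).
    have := key x d; rewrite stepW; move ey: (Phi *m x) => y.
    rewrite !mulmxDr !fipDl !fipDr !mulmxN !fipNl !fipNr.
    have -> : fip (K *m x) (R *m d) = fip d (R *m K *m x).
      by rewrite fipC fip_mull RT mulmxA.
    have -> : fip y (P *m (B *m d)) = fip d (B^T *m P *m Phi *m x).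
      by rewrite fipC fip_mull PT fip_mull -ey !mulmxA.
    have -> : fip (B *m d) (P *m y) = fip d (B^T *m P *m Phi *m x).
      by rewrite fip_mull -ey !mulmxA.
    rewrite /w ?fipDr ?fipNr ?(mulmxA R K x). lra.
  (* Along d = t w the polynomial has no constant term, so its linear coefficient <w, w> is 0. *)
  have q : fip w w ^+ 2 <= 0 * (fip w (R *m w) + fip (B *m w) (P *m (B *m w))).
    apply: quad_discr => t; rewrite add0r; have := h (t *: w).
    by rewrite -!scalemxAr !fipZl !fipZr; congr (_ <= _); ring.
  apply: fnorm_eq0; apply/eqP; rewrite -sqrf_eq0 fnorm_sqr -sqrf_eq0 eq_le sqr_ge0 andbT.
  by rewrite mul0r in q.
have RK : R *m K = B^T *m P *m Phi.
  apply/matrixP => i j; have /matrixP/(_ i 0) := stat (delta_mx j 0).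
  by rewrite -!colE !mxE => /eqP; rewrite subr_eq0 => /eqP ->.
exists P => //; rewrite {1}eP -addrA; congr (_ + _).
have -> : Phi^T = A^T - K^T *m B^T by rewrite linearB /= trmx_mul.
by rewrite !mulmxBl -(mulmxA K^T) RK !mulmxA addrC subrK.
Qed.

End Optimality.

(** * Decay of the optimal gain *)

Section Decay.
Variables (F : realType) (n m : nat).
Variables (A : 'M[F]_n) (B : 'M[F]_(n, m)) (Q : 'M[F]_n) (R : 'M[F]_m).
Variables (L a gam : F) (C : 'M[F]_n) (K : 'M[F]_(m, n)).
Hypotheses (L1 : 1 < L) (a01 : 0 < a < 1) (g01 : 0 < gam < 1).
Hypotheses (hA : opbound A L) (hB : opbound B L) (hQ : opbound Q L) (hR : opbound R L).
Hypotheses (hRg : psdmx_ge R gam%:M) (stab : stabilizable L a A B).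
Hypotheses (CT : C^T = C) (CC : C *m C = Q) (det : detectable L a A C).
Hypotheses (QT : Q^T = Q) (RT : R^T = R).
Hypotheses (Q0 : forall x : 'cV[F]_n, 0 <= fip x (Q *m x)).
Hypotheses (optK : lqr_optimal_gain A B Q R K).

Local Notation Phi := (A - B *m K).
Local Notation lo := (gammaH L a gam).
Local Notation up := (constLH L a).

Definition initial_rhs T (x0 : 'cV[F]_n) : 'M[F]_(n + m + n, T) :=
  col_mx 0 (traj T (fun t => if t == 0%N then - x0 else 0)).

(** With multiplier P x(t) every row holds exactly except at t = T - 1, where the operator has lost
    the term in P x(T). *)
Lemma kkt_closed_loop (P : 'M[F]_n) (x0 : 'cV[F]_n) T :
  P = Q + A^T *m P *m Phi -> R *m K = B^T *m P *m Phi ->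
  kkt A B Q R (col_mx (col_mx (traj T (fun t => Phi ^+ t *m x0))
                              (traj T (fun t => - (K *m (Phi ^+ t *m x0)))))
                      (traj T (fun t => P *m (Phi ^+ t *m x0)))) =
  initial_rhs T x0 +
  col_mx (col_mx (traj T (fun t => if t.+1 == T then - (A^T *m (P *m (Phi ^+ T *m x0))) else 0))
                 (traj T (fun t => if t.+1 == T then - (B^T *m (P *m (Phi ^+ T *m x0))) else 0))) 0.
Proof.
move=> eP eR; rewrite kktE (feasible_residual T (closed_loop_feasible A B K x0)).
have e0 : (0 : 'M[F]_(n + m, T)) = col_mx 0 0 by rewrite col_mx0.
rewrite /initial_rhs e0 !add_col_mx !add0r addr0.
have Phi_S t : Phi ^+ t.+1 *m x0 = Phi *m (Phi ^+ t *m x0) by rewrite exprS mulmxA.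
congr (col_mx (col_mx _ _) _).
  rewrite !mul_traj traj_shiftT trajN !trajD; apply: eq_traj => t lt.
  have [lt'|ge] := ltnP t.+1 T; rewrite ?(ltn_eqF lt').
    rewrite Phi_S; move: (Phi ^+ t *m x0) => y.
    by rewrite addrA {2}eP (mulmxDl Q) !mulmxA subrr.
  have eT : t.+1 = T by apply/eqP; rewrite eqn_leq lt ge.
  rewrite -eT eqxx Phi_S; move: (Phi ^+ t *m x0) => y.
  by rewrite {1}eP (mulmxDl Q) !mulmxA add0r opprD addNKr.
rewrite !mul_traj traj_shiftT !trajD; apply: eq_traj => t lt.
have [lt'|ge] := ltnP t.+1 T; rewrite ?(ltn_eqF lt').
  rewrite Phi_S; move: (Phi ^+ t *m x0) => y.
  by rewrite mulmxN !mulmxA eR addNr.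
have eT : t.+1 = T by apply/eqP; rewrite eqn_leq lt ge.
rewrite -eT eqxx Phi_S; move: (Phi ^+ t *m x0) => y.
by rewrite mulmxN !mulmxA eR addr0.
Qed.

(** K x0 is minus the control at time 0, and [E] picks rows on which the iterate vanishes, so the
    iteration error bounds it. The hypothesis ranges over all [T] because the horizon depends on the
    tolerance [e]. *)
Lemma gain_decay p (E : 'M[F]_(p, m)) (x0 : 'cV[F]_n) k : opbound E 1 ->
  (forall T, E *m dsubmx (usubmx
     (richardson (@kkt F n m T A B Q R) lo up (initial_rhs T x0) k)) = 0) ->
  fnorm (E *m (K *m x0)) <= rho L a gam ^+ (2 * k) / lo * fnorm x0.
Proof.
move=> hE hz; have L0 : 0 <= L by apply: ltW; apply: lt_trans L1.
have [/andP[a0 a1] /andP[g0 g1]] := (a01, g01).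
have R0 (u : 'cV[F]_m) : 0 <= fip u (R *m u).
  by apply: le_trans (psd_fip_ge hRg u); rewrite mulr_ge0 ?sqr_ge0 // ltW.
have [P eP eR] := costate_equations Q0 R0 L1 a0 a1 g0 hB hQ hR hRg stab CT CC det QT RT optK.
have lo0 := gammaH_gt0 L1 a01 g01.
have lu : lo < up := le_lt_trans (gammaH_le1 L1 a01 g01) (constLH_gt1 a L1).
have up0 := lt_trans lo0 lu.
rewrite exprM rho_sqr //; set q := _ / (up ^+ 2 + _).
set w := 2 / (lo ^+ 2 + up ^+ 2) * up.
have w0 : 0 <= w by rewrite mulr_ge0 ?(ltW up0) // divr_ge0 // addr_ge0 ?sqr_ge0.
have q0 : 0 <= q by rewrite /q -rho_sqr // sqr_ge0.
have qk0 : 0 <= q ^+ k by rewrite exprn_ge0.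
have kw0 : 0 <= q ^+ k / lo + k%:R * w.
  by apply: addr_ge0; [rewrite divr_ge0 // ltW | apply: mulr_ge0].
have c0 : 0 <= 2 * L * fnorm P * (q ^+ k / lo + k%:R * w).
  by rewrite mulr_ge0 // mulr_ge0 // mulr_ge0.
(* The factor by which |x(T)| enters the error: |r| <= 2 L |P| |x(T)|, multiplied by the two
   coefficients of |r|. *)
set c := 2 * L * fnorm P * _ in c0.
apply/ler_addgt0Pl => e e0.
have d0 : 0 < e / (c + 1) by rewrite divr_gt0 // ltr_wpDl.
have [T T1 hT] := closed_loop_small Q0 R0 L1 a0 a1 g0 hB hQ hR hRg stab CT CC det optK x0 d0 1%N.
have := kkt_closed_loop x0 T eP eR.
set x := traj T _; set u := traj T _; set y := traj T (fun t => P *m _).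
set r := col_mx _ 0; set z := col_mx _ y => ez.
have fD (Z W : 'M[F]_(n + m + n, T)) := kktD A B Q R Z W.
have fZ s (Z : 'M[F]_(n + m + n, T)) := kktZ A B Q R s Z.
have flo (Z : 'M[F]_(n + m + n, T)) : lo * fnorm Z <= fnorm (kkt A B Q R Z).
  rewrite mulrC -ler_pdivlMr // mulrC.
  have [h _] := gammaH_inv_ge L1 a01 g01.
  have := kkt_lower L0 hB hQ hR L1 a0 a1 g0 g1 hRg stab CT CC det Z.
  by move=> /le_trans; apply; rewrite ler_wpM2r.
have fup (Z : 'M[F]_(n + m + n, T)) : fnorm (kkt A B Q R Z) <= up * fnorm Z.
  apply: (le_trans (kkt_upper L0 hA hB hQ hR Z)).
  by rewrite ler_wpM2r // constLH_ge.
have fs (Z W : 'M[F]_(n + m + n, T)) := kkt_sym A B QT RT Z W.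
have := richardson_error fD fZ fs lo0 lu flo fup k ez.
rewrite -/w -/q; set zk := richardson _ _ _ _ _ => err.
have nb : fnorm (initial_rhs T x0) <= fnorm x0.
  rewrite /initial_rhs; apply: (le_trans (fnorm_col_mx_le _ _)).
  by rewrite fnorm0 add0r -(fnormN x0) fnorm_traj0.
have nr : fnorm r <= 2 * L * fnorm P * (e / (c + 1)).
  apply: (le_trans (fnorm_col_mx_le _ _)); rewrite fnorm0 addr0.
  apply: (le_trans (fnorm_col_mx_le _ _)).
  have last N (v : 'cV[F]_N) : fnorm (traj T (fun t => if t.+1 == T then v else 0)) <= fnorm v.
    rewrite (@fnorm_traj1 _ _ _ _ T.-1) ?prednK ?eqxx // => t nt.
    by case: eqP => // et; case/eqP: nt; rewrite -et.
  have PX : L * fnorm (P *m (Phi ^+ T *m x0)) <= L * (fnorm P * (e / (c + 1))).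
    rewrite ler_wpM2l //; apply: (le_trans (opbound_fnorm _ _)).
    by rewrite ler_wpM2l // ltW.
  have hAx := opbound_tr L0 hA (P *m (Phi ^+ T *m x0)).
  have hBx := opbound_tr L0 hB (P *m (Phi ^+ T *m x0)).
  have := last _ (- (A^T *m (P *m (Phi ^+ T *m x0)))).
  have := last _ (- (B^T *m (P *m (Phi ^+ T *m x0)))).
  rewrite !fnormN; lra.
have nz : fnorm z <= (fnorm x0 + fnorm r) / lo.
  rewrite ler_pdivlMr // mulrC; apply: (le_trans (flo z)); rewrite ez.
  by apply: (le_trans (fnormD _ _)); rewrite lerD2r.
have Eu : fnorm (E *m (K *m x0)) <= fnorm (zk - z).
  have -> : E *m (K *m x0) = - (E *m col (Ordinal T1) u).
    by rewrite /u col_traj /= expr0 mul1mx mulmxN opprK.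
  rewrite fnormN.
  apply: (@le_trans _ _ (fnorm (E *m u))).
    rewrite -(ler_pXn2r (ltn0Sn 1)) ?nnegrE // !fnorm_sqr (fip_sum_col (E *m u)).
    rewrite (bigD1 (Ordinal T1)) //= !colE mulmxA lerDl.
    by apply: sumr_ge0 => s _; apply: fip_ge0.
  have -> : E *m u = E *m (u - dsubmx (usubmx zk)) by rewrite mulmxBr hz subr0.
  apply: (le_trans (fnorm_mull _ ler01 hE)); rewrite mul1r -fnormN opprB.
  have -> : dsubmx (usubmx zk) - u = dsubmx (usubmx (zk - z)).
    by rewrite !linearB /= /z col_mxKu col_mxKd.
  rewrite -[in leRHS](vsubmxK (zk - z)); apply: le_trans (fnorm_col_mx_u _ _).
  rewrite -[in leRHS](vsubmxK (usubmx _)); exact: fnorm_col_mx_d.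
apply: (le_trans Eu); apply: (le_trans err).
have h1 := ler_wpM2l qk0 nz.
have h2 := ler_wpM2l kw0 nr.
have h3 : c * (e / (c + 1)) <= e.
  rewrite mulrCA ler_piMr ?(ltW e0) // ler_pdivrMr ?mul1r ?lerDl //.
  by rewrite ltr_wpDl.
have e1 : q ^+ k * ((fnorm x0 + fnorm r) / lo) = q ^+ k / lo * fnorm x0 + q ^+ k / lo * fnorm r by ring.
have e2 : (q ^+ k / lo + k%:R * w) * (2 * L * fnorm P * (e / (c + 1))) = c * (e / (c + 1)).
  by rewrite /c; ring.
rewrite e1 in h1; rewrite e2 mulrDl in h2.
move: h1 h2; rewrite -[k%:R * w * _]mulrA; lra.
Qed.

End Decay.

(** * Propagation along the graph *)

Section Reach.
Variables (V : finType) (e : rel V) (j : V).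

(** The strict inequality makes [reach 0] empty, the support of the zero iterate, and [reach 1] the
    node [j] alone. Walks may repeat nodes, which makes extension by an edge immediate. *)
Definition reach (k : nat) (i : V) : Prop :=
  exists p : seq V, [/\ path e i p, last i p = j & (size p < k)%N].

Lemma reach_step k i i' : (i == i') || e i i' -> reach k i' -> reach k.+1 i.
Proof.
move=> + [p [pp lp sp]]; case/orP => [/eqP->|ei].
  by exists p; split=> //; apply: ltnW.
by exists (i' :: p); rewrite /= ei.
Qed.

Lemma reachS k i : reach k i -> reach k.+1 i.
Proof. by apply: reach_step; rewrite eqxx. Qed.

Lemma reach_gdist k i : reach k i -> exists2 d, gdist e i j = Some d & (d < k)%N.
Proof.
move=> [p [pp lp sp]].
have [q [pq lq uq sq]] : exists q, [/\ path e i q, last i q = j, uniq (i :: q) & (size q < k)%N].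
  case/shortenP: pp lp => q pq uq sub lq; exists q; split => //.
  apply: leq_ltn_trans sp; apply: uniq_leq_size => //.
  by case/andP: uq.
have hq : has_path e i j (size q).
  by apply/existsP; exists (in_tuple q); rewrite /= pq lq eqxx.
rewrite /gdist; case: pselect => [ex|[]]; last by exists (size q).
by case: ex_minnP => d _ /(_ _ hq) le; exists d => //; apply: leq_ltn_trans sq.
Qed.

End Reach.

Section Sparsity.
Variables (F : realType) (V : finType) (e : rel V).

(** [na] and [nb] give the node owning each row and column index, so sparsity is stated on scalar
    entries without block structure. *)
Definition banded a b (na : 'I_a -> V) (nb : 'I_b -> V) (M : 'M[F]_(a, b)) :=
  forall s t, na s != nb t -> ~~ e (na s) (nb t) -> M s t = 0.

Definition supported a T (na : 'I_a -> V) (S : V -> Prop) (Z : 'M[F]_(a, T)) :=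
  forall s t, ~ S (na s) -> Z s t = 0.

Lemma banded_tr a b (na : 'I_a -> V) (nb : 'I_b -> V) (M : 'M[F]_(a, b)) :
  symmetric e -> banded na nb M -> banded nb na M^T.
Proof. by move=> se h s t n1 n2; rewrite mxE h // 1?eq_sym // se. Qed.

Lemma supportedW a T (na : 'I_a -> V) (S S' : V -> Prop) (Z : 'M[F]_(a, T)) :
  (forall i, S i -> S' i) -> supported na S Z -> supported na S' Z.
Proof. by move=> h hZ s t n; apply: hZ => /h. Qed.

Lemma supported0 a T (na : 'I_a -> V) S : supported na S (0 : 'M[F]_(a, T)).
Proof. by move=> s t _; rewrite mxE. Qed.

Lemma supportedD a T (na : 'I_a -> V) S (Z W : 'M[F]_(a, T)) :
  supported na S Z -> supported na S W -> supported na S (Z + W).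
Proof. by move=> hZ hW s t n; rewrite mxE hZ // hW // addr0. Qed.

Lemma supportedZ a T (na : 'I_a -> V) S c (Z : 'M[F]_(a, T)) :
  supported na S Z -> supported na S (c *: Z).
Proof. by move=> hZ s t n; rewrite mxE hZ // mulr0. Qed.

Lemma supportedN a T (na : 'I_a -> V) S (Z : 'M[F]_(a, T)) :
  supported na S Z -> supported na S (- Z).
Proof. by move=> hZ; rewrite -scaleN1r; apply: supportedZ. Qed.

Lemma supported_mulr a T T' (na : 'I_a -> V) S (Z : 'M[F]_(a, T)) (D : 'M[F]_(T, T')) :
  supported na S Z -> supported na S (Z *m D).
Proof. by move=> hZ s t n; rewrite mxE big1 // => r _; rewrite hZ ?mul0r. Qed.

Lemma supported_mull a b T (na : 'I_a -> V) (nb : 'I_b -> V) j k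
    (M : 'M[F]_(a, b)) (Z : 'M[F]_(b, T)) :
  banded na nb M -> supported nb (reach e j k) Z ->
  supported na (reach e j k.+1) (M *m Z).
Proof.
move=> hM hZ s t n; rewrite mxE big1 // => r _.
have [adj|] := boolP ((na s == nb r) || e (na s) (nb r)).
  by rewrite hZ ?mulr0 // => h; apply: n; apply: reach_step adj h.
by rewrite negb_or => /andP[h1 h2]; rewrite hM ?mul0r.
Qed.

Variables (n m : nat) (nn : 'I_n -> V) (nm : 'I_m -> V).

Definition kkt_supported T (S : V -> Prop) (Z : 'M[F]_(n + m + n, T)) :=
  [/\ supported nn S (usubmx (usubmx Z)), supported nm S (dsubmx (usubmx Z))
    & supported nn S (dsubmx Z)].

Lemma kkt_supportedW T (S S' : V -> Prop) (Z : 'M[F]_(n + m + n, T)) :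
  (forall i, S i -> S' i) -> kkt_supported S Z -> kkt_supported S' Z.
Proof. by move=> h [h1 h2 h3]; split; apply: supportedW h _. Qed.

Lemma kkt_supportedD T S (Z W : 'M[F]_(n + m + n, T)) :
  kkt_supported S Z -> kkt_supported S W -> kkt_supported S (Z + W).
Proof. by move=> [? ? ?] [? ? ?]; split; rewrite !linearD; apply: supportedD. Qed.

Lemma kkt_supportedZ T S c (Z : 'M[F]_(n + m + n, T)) :
  kkt_supported S Z -> kkt_supported S (c *: Z).
Proof. by move=> [? ? ?]; split; rewrite !linearZ; apply: supportedZ. Qed.

Variables (A : 'M[F]_n) (B : 'M[F]_(n, m)) (Q : 'M[F]_n) (R : 'M[F]_m).
Hypotheses (se : symmetric e).
Hypotheses (bA : banded nn nn A) (bB : banded nn nm B).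
Hypotheses (bQ : banded nn nn Q) (bR : banded nm nm R).

Lemma kkt_supported_kkt T j k (Z : 'M[F]_(n + m + n, T)) :
  kkt_supported (reach e j k) Z -> kkt_supported (reach e j k.+1) (kkt A B Q R Z).
Proof.
move=> [hX hU hY].
have <- : col_mx (col_mx (usubmx (usubmx Z)) (dsubmx (usubmx Z))) (dsubmx Z) = Z by rewrite !vsubmxK.
move: (usubmx (usubmx Z)) (dsubmx (usubmx Z)) (dsubmx Z) hX hU hY => X U Y hX hU hY.
have up N (nu : 'I_N -> V) (W : 'M[F]_(N, T)) :
  supported nu (reach e j k) W -> supported nu (reach e j k.+1) W.
  by apply: supportedW => i; apply: reachS.
have bAT := banded_tr se bA; have bBT := banded_tr se bB.
rewrite kktE /kkt_supported !(col_mxKu, col_mxKd); split.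
- apply: supportedD; first exact: supported_mull hX.
  apply: supportedD; last by apply: supportedN; apply: up.
  by apply: supported_mulr; apply: supported_mull hY.
- apply: supportedD; first exact: supported_mull hU.
  by apply: supported_mulr; apply: supported_mull hY.
- apply: supportedD; last by apply: supportedN; apply: up.
  by apply: supported_mulr; apply: supportedD; [apply: supported_mull hX|apply: supported_mull hU].
Qed.

(** Each step applies [kkt] twice, and each application spreads the support by one edge; time shifts
    act on the right and move nothing between nodes. *)
Lemma richardson_supported T j lo up (b : 'M[F]_(n + m + n, T)) k :
  kkt_supported (reach e j 1) b ->
  kkt_supported (reach e j (2 * k)) (richardson (kkt A B Q R) lo up b k).
Proof.
move=> hb; elim: k => [|k ih].
  by split; rewrite /= !linear0; apply: supported0.
have mono l l' i : (l <= l')%N -> reach e j l i -> reach e j l' i.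
  by move=> ll [p [? ? sp]]; exists p; split=> //; apply: leq_trans ll.
rewrite mulnS add2n; apply: kkt_supportedD.
  by apply: kkt_supportedW ih => i; apply: mono; apply: leqW.
apply: kkt_supportedZ; apply: kkt_supported_kkt; apply: kkt_supportedD.
  by apply: kkt_supportedW hb => i; apply: mono.
by rewrite -scaleN1r; apply: kkt_supportedZ; apply: kkt_supported_kkt.
Qed.

End Sparsity.

(** * Block embeddings and the final estimate *)

Lemma fnorm_colsub1 (F : realType) n p (g : 'I_p -> 'I_n) (y : 'cV[F]_p) :
  injective g -> fnorm (colsub g 1%:M *m y) = fnorm y.
Proof.
move=> ig; rewrite /fnorm fip_mull mulmxA.
suff -> : (colsub g (1%:M : 'M[F]_n))^T *m colsub g 1%:M = 1%:M by rewrite mul1mx.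
rewrite -[(colsub _ _)^T](_ : rowsub g 1%:M = _); last first.
  by apply/matrixP => i j; rewrite !mxE eq_sym.
rewrite -mxsub_mul mulmx1; apply/matrixP => i j; rewrite !mxE.
by rewrite (inj_eq ig).
Qed.

(** Selecting coordinates is the adjoint of the isometric embedding that fills the others with 0. *)
Lemma opbound_rowsub1 (F : realType) n p (g : 'I_p -> 'I_n) :
  injective g -> opbound (rowsub g (1%:M : 'M[F]_n)) 1.
Proof.
move=> ig; have -> : rowsub g (1%:M : 'M[F]_n) = (colsub g 1%:M)^T.
  by apply/matrixP => i j; rewrite !mxE eq_sym.
by apply: opbound_tr => // y; rewrite fnorm_colsub1 // mul1r.
Qed.

Lemma Rank_inj (N : nat) (p : 'I_N -> nat) (i : 'I_N) : injective (@tagnat.Rank N p i).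
Proof.
move=> a b /eqP; rewrite -val_eqE tagnat.eq_Rank eqxx /= => /eqP h.
exact: val_inj.
Qed.

Lemma le_geometric_le0 (F : realType) (x a q : F) :
  `|q| < 1 -> (forall k, x <= a * q ^+ k) -> x <= 0.
Proof.
move=> q1 h; rewrite -(cvg_lim (@Rhausdorff F) (cvg_geometric a q1)).
apply: limr_ge; first by apply: cvgP (cvg_geometric a q1).
by near=> k; apply: h.
Unshelve. all: by end_near. Qed.

Theorem theorem3p3 (F : realType) (N : nat) (e : rel 'I_N)
  (nx nu : 'I_N -> nat)
  (Ab : forall i j : 'I_N, 'M[F]_(nx i, nx j))
  (Bb : forall i j : 'I_N, 'M[F]_(nx i, nu j))
  (Qb : forall i j : 'I_N, 'M[F]_(nx i, nx j))
  (Rb : forall i j : 'I_N, 'M[F]_(nu i, nu j))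
  (L alpha gamma : F)
  (K : 'M[F]_(\sum_(i < N) nu i, \sum_(j < N) nx j)) :
  let A := \mxblock_(i < N, j < N) Ab i j in
  let B := \mxblock_(i < N, j < N) Bb i j in
  let Q := \mxblock_(i < N, j < N) Qb i j in
  let R := \mxblock_(i < N, j < N) Rb i j in
  symmetric e -> irreflexive e ->
  (forall i j : 'I_N, Qb i j = (Qb j i)^T) ->
  (forall i j : 'I_N, Rb i j = (Rb j i)^T) ->
  (forall i j : 'I_N, i != j -> ~~ e i j ->
     [/\ Ab i j = 0, Bb i j = 0, Qb i j = 0 & Rb i j = 0]) ->
  1 < L -> 0 < alpha < 1 -> 0 < gamma < 1 ->
  [/\ mxnorm2 A <= L, mxnorm2 B <= L, mxnorm2 Q <= L & mxnorm2 R <= L] ->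
  psdmx_ge R gamma%:M ->
  stabilizable L alpha A B ->
  psdmx Q ->
  (exists2 S, is_psd_sqrt Q S & detectable L alpha A S) ->
  lqr_optimal_gain A B Q R K ->
  [/\ forall i j : 'I_N,
        mxnorm2 (submxblock K i j)
        <= Upsilon L alpha gamma * expr_dist (rho L alpha gamma) (gdist e i j),
      0 < rho L alpha gamma < 1
    & 1 <= Upsilon L alpha gamma].
Proof.
move=> A B Q R se _ _ _ sparse L1 a01 g01 [nA nB nQ nR] hRg stab [QT Q0] [C [[CT _] CC] det] optK.
have hA := opbound_mxnorm2 nA; have hB := opbound_mxnorm2 nB.
have hQ := opbound_mxnorm2 nQ; have hR := opbound_mxnorm2 nR.
have rb := rho_bounds L1 a01 g01.
split; [|by []|exact: Upsilon_ge1].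
have RT : R^T = R.
  have [h _] := hRg; move: h; rewrite linearB /= tr_scalar_mx.
  exact: addIr.
have {}Q0 (x : 'cV[F]_(\sum_(i < N) nx i)) : 0 <= fip x (Q *m x) by rewrite -quadfE.
pose nn := @tagnat.sig1 N nx; pose nm := @tagnat.sig1 N nu.
have bA : banded e nn nn A.
  by move=> s t h1 h2; have [E _ _ _] := sparse _ _ h1 h2; rewrite mxE E mxE.
have bB : banded e nn nm B.
  by move=> s t h1 h2; have [_ E _ _] := sparse _ _ h1 h2; rewrite mxE E mxE.
have bQ : banded e nn nn Q.
  by move=> s t h1 h2; have [_ _ E _] := sparse _ _ h1 h2; rewrite mxE E mxE.
have bR : banded e nm nm R.
  by move=> s t h1 h2; have [_ _ _ E] := sparse _ _ h1 h2; rewrite mxE E mxE.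
have lo0 := gammaH_gt0 L1 a01 g01.
have bound i j k (y : 'cV[F]_(nx j)) : ~ reach e j (2 * k) i ->
   fnorm (submxblock K i j *m y) <= rho L alpha gamma ^+ (2 * k) / gammaH L alpha gamma * fnorm y.
  move=> far; rewrite -(fnorm_colsub1 y (@Rank_inj _ nx j)).
  (* Embed y as an initial state carried by node j, apply the full gain, and select the rows of node
     i. *)
  have -> : submxblock K i j *m y = rowsub (@tagnat.Rank _ nu i) 1%:M
       *m (K *m (colsub (@tagnat.Rank _ nx j) 1%:M *m y)).
    rewrite -rowsubE mulmxA mulmx_colsub mulmx1 -mul_rowsub_mx.
    by congr (_ *m _); apply/matrixP => s t; rewrite !mxE.
  apply: (gain_decay L1 a01 g01 hA hB hQ hR hRg stab CT CC det QT RT Q0 optK).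
    exact/opbound_rowsub1/Rank_inj.
  move=> T; rewrite -rowsubE; apply/matrixP => s t; rewrite !mxE.
  set x0 := colsub _ _ *m y.
  have hb : kkt_supported nn nm (reach e j 1) (@initial_rhs F _ (\sum_(i < N) nu i) T x0).
    rewrite /kkt_supported !(col_mxKu, col_mxKd) !linear0; split; try exact: supported0.
    move=> r t' nr; rewrite mxE; case: ifP => _; last by rewrite mxE.
    rewrite mxE /x0 mxE big1 ?oppr0 // => c _; rewrite !mxE.
    case: eqP => [er|]; last by rewrite mul0r.
    by case: nr; exists [::]; rewrite er /nn tagnat.Rank1K.
  have [_ h _] := richardson_supported se bA bB bQ bR (gammaH L alpha gamma) (constLH L alpha) k hb.
  have := h (tagnat.Rank i s) t; rewrite !mxE; apply.
  by rewrite /nm tagnat.Rank1K.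
move=> i j; apply: mxnorm2_le => y y1.
have /andP[r0 r1] := rb.
case E : (gdist e i j) => [d|] /=.
  (* The number of iterations is half the distance, rounded down. *)
  have far : ~ reach e j (2 * d./2) i.
    move=> /reach_gdist[d']; rewrite E => -[<-].
    by rewrite ltnNge mul2n -{2}(odd_double_half d) leq_addl.
  apply: (le_trans (bound _ _ _ y far)).
  apply: (@le_trans _ _ (rho L alpha gamma ^+ (2 * d./2) / gammaH L alpha gamma * 1)).
    by rewrite ler_wpM2l // divr_ge0 // ?exprn_ge0 // ltW.
  rewrite mulr1 /Upsilon mulrAC ler_pdivlMr ?mulr_gt0 ?exprn_gt0 //.
  have g1 := gammaH_le1 L1 a01 g01; have H1 := constLH_gt1 alpha L1.
  (* 2k + 1 >= d whatever the parity of d; the extra factor comes from the [rho] in the denominator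
     of [Upsilon]. *)
  have rd : rho L alpha gamma ^+ (2 * d./2).+1 <= rho L alpha gamma ^+ d.
    apply: ler_wiXn2l; rewrite ?ltW //.
    by rewrite -{1}(odd_double_half d) mul2n -add1n leq_add2r leq_b1.
  have -> : rho L alpha gamma ^+ (2 * d./2) / gammaH L alpha gamma *
      (gammaH L alpha gamma ^+ 2 * rho L alpha gamma) =
    gammaH L alpha gamma * rho L alpha gamma ^+ (2 * d./2).+1.
    by move: (2 * _)%N => l; rewrite (exprSr _ l); field; rewrite gt_eqF.
  apply: ler_pM => //; rewrite ?exprn_ge0 ?ltW //.
  exact: le_lt_trans H1.
rewrite mulr0.
(* Without a walk between the nodes the bound holds for every k, and its geometric decay forces the
   block to vanish. *)
have nor k : ~ reach e j k i by move=> /reach_gdist[d]; rewrite E.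
apply: (@le_geometric_le0 _ _ ((gammaH L alpha gamma)^-1 * fnorm y) (rho L alpha gamma ^+ 2)).
  by rewrite ger0_norm ?sqr_ge0 // exprn_ilt1 // ltW.
move=> k; apply: (le_trans (bound _ _ k y (nor _))).
by rewrite exprM -mulrA mulrC.
Qed.
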